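(* Let $\mathcal F$ be the class of non-constant Riemann integrable functions $f\colon[0,1]\to(0,\infty)$ with $\inf_{[0,1]}f>0$ and $\sup_{[0,1]}f<\infty$. For $f\in\mathcal F$ put $\beta_m=\int_{[0,1]}f^m(y)\,dy$. For $\lambda\in(0,\infty)$ let $\Delta_\phi$ be the friendship bias of the root of the multi-type Galton-Watson tree that is the local limit of the inhomogeneous Erdős-Rényi random graph with edge probabilities $\frac\lambda nf(\frac in)f(\frac jn)\wedge1$ (described in the context). Then for every $f\in\mathcal F$ and $\lambda\in(0,\infty)$, $$\mathbb E[\Delta_\phi]=1-(\lambda\beta_2+1)\int_{[0,1]}e^{-\lambda\beta_1f(x)}\,dx+\lambda(\beta_2-\beta_1^2)$$ and $$\begin{aligned}\mathbb E[\Delta_\phi^2]=\;&\lambda\big(\beta_2+\lambda(\beta_1\beta_3-\beta_2^2)\big)\int_{[0,1]}\sum_{k=1}^\infty k^{-1}\frac{e^{-\lambda\beta_1f(x)}(\lambda\beta_1f(x))^k}{k!}\,dx\\&-(\lambda^2\beta_2^2+2\lambda\beta_2+1)\int_{[0,1]}e^{-\lambda\beta_1f(x)}\,dx+\lambda^2(\beta_2^2-\beta_2\beta_1^2)+\lambda(2\beta_2-\beta_1^2)+1.\end{aligned}$$ In particular, $\lim_{\lambda\downarrow0}\mathbb E[\Delta_\phi]=0$, $\lim_{\lambda\downarrow0}\mathbb E[\Delta_\phi^2]=0$, $\lim_{\lambda\to\infty}\mathbb E[\Delta_\phi]=\infty$ and $\lim_{\lambda\to\infty}\mathbb E[\Del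ta_\phi^2]=\infty$.
   Context: The limiting rooted tree: the root $\phi$ has type $Q$ uniform on $[0,1]$; every vertex other than the root independently has a type with density $\beta_1^{-1}f(y)$, $y\in[0,1]$; given the types, a vertex of type $x$ independently has a Poisson($\lambda\beta_1f(x)$) number of children. Thus, with $d_\phi$ the number of children of the root and $d_j$ the number of children of the $j$-th child of the root, $d_\phi$ is mixed Poisson($\lambda\beta_1f(Q)$), and $d_1,d_2,\ldots$ are i.i.d., independent of $d_\phi$, each mixed Poisson($\lambda\beta_1f(Q'_j)$) with $Q'_j$ i.i.d. of density $\beta_1^{-1}f$. The friendship bias of the root is $$\Delta_\phi=\Big[\frac1{d_\phi}\sum_{j=1}^{d_\phi}(d_j+1)-d_\phi\Big]\mathbb 1_{\{d_\phi\ne0\}}$$ (so $\Delta_\phi=0$ when $d_\phi=0$).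
   Formalization: The limit of E[Δ_φ] as λ→∞ is claimed only for f not almost everywhere constant; for non-constant but a.e. constant f (e.g. f=1 except f(0)=2) that mean tends to 1, so the claim as stated is false there. *)

(* Defs.v *)
From HB Require Import structures.
From mathcomp Require Import all_boot all_order all_algebra finmap.
From mathcomp Require Import all_classical all_reals all_analysis.

Set Implicit Arguments.
Unset Strict Implicit.
Unset Printing Implicit Defensive.

Import Order.TTheory GRing.Theory Num.Theory.
Import numFieldTopology.Exports numFieldNormedType.Exports.

Local Open Scope classical_set_scope.
Local Open Scope ring_scope.

Section riemann.
Context {R : realType}.
Implicit Types (f : R -> R) (a b : R) (s : seq R).

(* As for itv_partition, the points of the partition are those of a :: s. *)
Definition darboux_lower_sum f a b s : R :=
  let x := nth b (a :: s) in
  \sum_(0 <= i < size s) inf (f @` `[x i, x i.+1]) * (x i.+1 - x i).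

Definition darboux_upper_sum f a b s : R :=
  let x := nth b (a :: s) in
  \sum_(0 <= i < size s) sup (f @` `[x i, x i.+1]) * (x i.+1 - x i).

Definition lower_riemann_integral f a b : R :=
  sup [set darboux_lower_sum f a b s | s in itv_partition a b].

Definition upper_riemann_integral f a b : R :=
  inf [set darboux_upper_sum f a b s | s in itv_partition a b].

Definition riemann_integrable f a b : Prop :=
  [bounded f x | x in `[a, b]] /\
  lower_riemann_integral f a b = upper_riemann_integral f a b.

End riemann.

Section kernel_class.
Context {R : realType}.
Implicit Type f : R -> R.

(* A function on [0, 1] is represented by any extension of it to R. *)
Record kernel_class f : Prop := KernelClass {
  kernel_gt0 : forall x, x \in `[0, 1] -> 0 < f x ;
  kernel_nonconstant :
    exists x y, [/\ x \in `[0, 1], y \in `[0, 1] & f x <> f y] ;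
  kernel_riemann : riemann_integrable f 0 1 ;
  kernel_inf_gt0 : (0 < ereal_inf [set (f x)%:E | x in `[0%R, 1%R]])%E ;
  kernel_sup_lty : (ereal_sup [set (f x)%:E | x in `[0%R, 1%R]] < +oo)%E
}.

(* A Riemann integrable f need not be Borel measurable.  For g >= 0, measurable
   or not, \int[lebesgue_measure]_(x in D) g x is the supremum of the integrals
   of the nonnegative Borel simple functions below g; for a Riemann integrable
   g >= 0 this is the Riemann integral. *)
Definition beta f (m : nat) : R :=
  \int[lebesgue_measure]_(y in `[0, 1]) (f y ^+ m).

(* kernel_nonconstant is a pointwise condition, which does not exclude functions
   that are equal to a constant almost everywhere; for those the mean of the
   friendship bias tends to 1, not to infinity, as lambda tends to infinity. *)
Definition ae_constant f : Prop :=
  exists c, {ae @lebesgue_measure R, forall x, x \in `[0, 1] -> f x = c}.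

End kernel_class.

Definition mutually_independent {R : realType} {d : measure_display}
    {T : measurableType d} (P : probability T R) {I : choiceType}
    {d' : measure_display} {T' : measurableType d'} (Y : I -> T -> T') : Prop :=
  forall (J : {fset I}) (A : I -> set T'), (forall i, measurable (A i)) ->
    P (\bigcap_(i in [set` J]) (Y i @^-1` A i)) =
    (\prod_(i <- J) P (Y i @^-1` A i))%E.

(* Vertices carry Ulam-Harris labels: [::] is the root and rcons v j is the
   (j+1)-st child of v.  Every label v gets a type X v and a number of children
   D v, whether or not v is a vertex of the tree; the tree consists of the v
   whose j-th letter is, for every j, smaller than D (take j v). *)
Record multitype_gw_tree {R : realType} {d : measure_display}
    {T : measurableType d} (P : probability T R) (f : R -> R) (lambda : R)
    (X : seq nat -> {RV P >-> R}) (D : seq nat -> {RV P >-> nat}) : Prop :=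
  MultitypeGWTree {
  gw_root_type : forall A, measurable A ->
    distribution P (X [::]) A = uniform_prob ltr01 A ;
  gw_type : forall v, v <> [::] -> forall A, measurable A ->
    distribution P (X v) A =
    (\int[lebesgue_measure]_(y in A `&` `[0%R, 1%R]) ((beta f 1)^-1 * f y)%:E)%E ;
  gw_offspring : forall v A k, measurable A ->
    P (X v @^-1` A `&` D v @^-1` [set k]) =
    (\int[distribution P (X v)]_(x in A `&` `[0%R, 1%R])
       (poisson_pmf (lambda * beta f 1 * f x) k)%:E)%E ;
  gw_independent :
    mutually_independent P (fun v (t : T) => (X v t, D v t))
}.

(* n v is the number of children of v; the j-th child of the root is adjacent
   to its children and to the root. *)
Definition friendship_bias {R : realType} (n : seq nat -> nat) : R :=
  let d := n [::] in
  if d == 0%N then 0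
  else d%:R^-1 * (\sum_(j < d) ((n [:: val j])%:R + 1)) - d%:R.

(* Main.v *)
(* On {d_phi = n} with n > 0 the bias is (Y_1 + ... + Y_n) / n - n, where the
   Y_j = d_j + 1 are independent of d_phi and of each other, so its first two
   moments there are P(d_phi = n) times m - n and
   v / n + m^2 - 2 m n + n^2, where m and v are the mean and variance of Y_1.
   Summing over n leaves the first two moments of the mixed Poisson variables
   d_phi and d_1 and the mean of 1 / d_phi.
   A Riemann integrable f agrees almost everywhere with a Borel function h (the
   supremum of a sequence of lower step functions whose Darboux sums converge),
   and every integral of a nonnegative function of f is that of h.
   The limits follow from 1 - lambda beta_1^2 <= E[exp(- lambda beta_1 f)] <= 1,
   from t exp(-t) <= 1 and t^2 exp(-t) <= 2, and from the Cauchy-Schwarz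
   inequalities beta_1^2 <= beta_2 and beta_2^2 <= beta_1 beta_3. *)
Require Import Defs.
From HB Require Import structures.
From mathcomp Require Import all_boot all_order all_algebra finmap.
From mathcomp Require Import all_classical all_reals all_analysis.
From mathcomp Require Import measurable_realfun ring lra.

Set Implicit Arguments.
Unset Strict Implicit.
Unset Printing Implicit Defensive.

Import Order.TTheory GRing.Theory Num.Theory.
Import numFieldTopology.Exports numFieldNormedType.Exports.
Local Open Scope classical_set_scope.
Local Open Scope ring_scope.

(** The obstacle is that f need not be Borel. The integral of a nonnegative function is a supremum
    over simple functions below it; almost everywhere comparison survives for such integrands,
    linearity and monotone convergence do not. So f is exchanged for h inside each nonnegative
    integrand before anything is expanded, both in the type laws and in the final formulas. Moments
    are computed as extended real integrals and series of nonnegative terms, where Tonelli is free;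
    real subtraction occurs only between quantities already known to be finite. Conditioning is
    replaced by integrals over the events [D v = n], so independence is needed only for finitely
    many counts at a time. The convention [0%:R^-1 = 0] absorbs the childless root, and the
    indicator in the bias disappears. No limit of the inverse-count series is computed: as it lies
    between 0 and 1, bounds on the moments that are linear in lambda give all four limits. *)

(** * Integrals of nonnegative functions *)
Section integral_lemmas.
Context d (T : measurableType d) (R : realType).
Implicit Types (mu nu : {measure set T -> \bar R}) (D : set T).
Local Open Scope ereal_scope.

Import HBNNSimple.

(** Holds for nonmeasurable g and h because the integral is a supremum over simple functions below
    the integrand; the kernel f is compared with its Borel representative in this way. *)
Lemma ge0_le_integral_ae mu D (g h : T -> \bar R) :
  (forall x, D x -> 0 <= g x) -> (forall x, D x -> 0 <= h x) ->
  {ae mu, forall x, D x -> g x <= h x} ->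
  \int[mu]_(x in D) g x <= \int[mu]_(x in D) h x.
Proof.
move=> g0 h0 [N [mN muN0 gh]].
rewrite !ge0_integralE//; apply: ge_ereal_sup => _ [k /= kg <-].
have mCN := measurableC mN.
(* A simple function below g becomes one below h once it is cut off on N. *)
pose k' := proj_nnsfun k mCN.
have -> : sintegral mu k = sintegral mu k'.
  rewrite -integralT_nnsfun (ge0_negligible_integral mN)//; last 2 first.
  - by apply/measurable_EFinP; exact/measurable_funTS/measurable_funP.
  - by move=> x _; rewrite lee_fin.
  rewrite setTD integral_nnsfun//; apply: eq_sintegral => x /=.
  by rewrite patchE mindicE; case: ifPn => _; rewrite ?mulr1 ?mulr0.
apply: ereal_sup_ubound; exists k' => //= x.
rewrite mindicE; have [|] := boolP (x \in ~` N); last first.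
  by rewrite mulr0 patchE => _; case: ifPn => // /set_mem /h0.
rewrite mulr1 => /set_mem /= Nx.
have {}kg := kg x; rewrite !patchE in kg *; case: ifPn => [|/negbTE] xD.
  rewrite xD in kg.
  apply: (le_trans kg); apply: contrapT => ghx; apply: Nx; apply: gh => /=.
  by move=> /(_ (set_mem xD)).
by rewrite xD in kg.
Qed.

Lemma ge0_eq_integral_ae mu D (g h : T -> \bar R) :
  (forall x, D x -> 0 <= g x) -> (forall x, D x -> 0 <= h x) ->
  {ae mu, forall x, D x -> g x = h x} ->
  \int[mu]_(x in D) g x = \int[mu]_(x in D) h x.
Proof.
move=> g0 h0 gh; apply/eqP; rewrite eq_le; apply/andP; split;
  by apply: ge0_le_integral_ae => //; apply: filterS gh => x gh /gh ->.
Qed.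

(** Monotone convergence reduces [phi] to its simple approximations, linearity to the indicators of
    their level sets, and for these the identity is the hypothesis on [nu]. *)
Lemma ge0_integral_density mu nu (w : T -> R) (phi : T -> \bar R) D :
  measurable D -> measurable_fun D w -> (forall x, D x -> 0 <= w x)%R ->
  measurable_fun D phi -> (forall x, D x -> 0 <= phi x) ->
  (forall A, measurable A -> A `<=` D ->
    nu A = \int[mu]_(x in A) (w x)%:E) ->
  \int[nu]_(x in D) phi x = \int[mu]_(x in D) (phi x * (w x)%:E).
Proof.
move=> mD mw w0 mphi phi0 nuE.
pose h := nnsfun_approx mD mphi.
have hphi x : D x -> EFin (h n x) @[n --> \oo] --> phi x.
  by move=> Dx; apply: cvg_nnsfun_approx => // ? ?; exact: phi0.
have ndh x : {homo (fun n => (h n x)%:E) : a b / (a <= b)%N >-> a <= b}.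
  by move=> a b ab; rewrite lee_fin; exact/lefP/nd_nnsfun_approx.
have mh n : measurable_fun D (EFin \o h n).
  by apply/measurable_EFinP; exact/measurable_funTS/measurable_funP.
have mwE : measurable_fun D (EFin \o w) by exact/measurable_EFinP.
have ED : \int[nu]_(x in D) phi x = limn (fun n => \int[nu]_(x in D) (h n x)%:E).
  rewrite -monotone_convergence//; last first.
    by move=> n x _; rewrite lee_fin.
  apply: eq_integral => x /set_mem Dx.
  by apply/esym/cvg_lim => //; exact: hphi.
rewrite {}ED.
transitivity (limn (fun n => \int[mu]_(x in D) ((h n x)%:E * (w x)%:E))); last first.
  rewrite -monotone_convergence//; last 3 first.
  - by move=> n; exact: (emeasurable_funM (mh n) mwE).
  - by move=> n x Dx; rewrite mule_ge0 ?lee_fin ?w0.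
  - by move=> x Dx a b ab; rewrite lee_wpmul2r ?lee_fin ?w0//; exact: ndh.
  apply: eq_integral => x /set_mem Dx.
  by apply/cvg_lim => //; apply: cvgeZr => //; exact: hphi.
congr (limn _); apply/funext => n.
transitivity (\int[nu]_(x in D)
   (\sum_(y \in range (h n)) (y * \1_(h n @^-1` [set y]) x)%:E)).
  by apply: eq_integral => t tD; rewrite /= fimfunE -fsumEFin.
have indich r : measurable_fun D (fun x => (r * \1_(h n @^-1` [set r]) x)%:E).
  by apply/measurable_EFinP/measurable_funTS/measurable_funM.
rewrite ge0_integral_fsum//; last by move=> m y Ey; exact: nnfun_muleindic_ge0.
transitivity (\int[mu]_(x in D) (\sum_(y \in range (h n))
    (y * \1_(h n @^-1` [set y]) x)%:E * (w x)%:E)); last first.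
  under eq_integral => x xD.
    rewrite -ge0_mule_fsuml => [|y]; last exact: nnfun_muleindic_ge0.
    rewrite fsumEFin // -(fimfunE _ x); over.
  by [].
rewrite ge0_integral_fsum//; last 2 first.
- by move=> y; exact: emeasurable_funM.
- by move=> m y Dy; apply: mule_ge0; [exact: nnfun_muleindic_ge0|rewrite lee_fin w0].
apply: eq_fsbigr => r rhn.
under eq_integral do rewrite EFinM.
rewrite integralZl_indic_nnsfun => //.
under [RHS]eq_integral do rewrite EFinM -muleA.
have mI : measurable (h n @^-1` [set r] `&` D) by exact: measurableI.
rewrite ge0_integralZl//; last 3 first.
- by apply: emeasurable_funM => //; exact/measurable_EFinP.
- by move=> x Dx; rewrite mule_ge0// lee_fin ?w0//.
- by move: rhn => /set_mem[y _ <-]; rewrite lee_fin.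
under [in RHS]eq_integral do rewrite muleC.
rewrite [in RHS](eq_integral ((EFin \o w) \_ (h n @^-1` [set r]))); last first.
  by move=> x xD; rewrite epatch_indic.
rewrite -integral_mkcondr integral_indic// nuE//.
by rewrite setIC.
Qed.

End integral_lemmas.

(** * Riemann integrable functions *)

Section riemann_borel.
Context {R : realType}.
Implicit Types (F : set R -> R) (a b c M x y : R) (s : seq R) (f : R -> R).
Local Notation mu := (@lebesgue_measure R).

(* With F I the infimum (resp. supremum) of f on I, the integral of this step
   function is the lower (resp. upper) Darboux sum. *)
Fixpoint partition_step F a s x : R :=
  if s is y :: s' then
    if x <= y then F `[a, y]%classic else partition_step F y s' x
  else 0.

Lemma measurable_partition_step F a s : measurable_fun setT (partition_step F a s).
Proof.
elim: s a => [a|y s ih a] /=; first exact: measurable_cst.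
by apply: measurable_fun_ifT => //; exact: measurable_fun_ler.
Qed.

(** Locates x in a closed cell over which F is evaluated; with an infimum or a supremum for F, the
    step function then lies below or above f at x. *)
Lemma partition_stepP F a s x : path <%R a s -> a < last a s ->
  a <= x <= last a s ->
  exists p q, [/\ a <= p, p <= x, x <= q, q <= last a s &
                  partition_step F a s x = F `[p, q]%classic].
Proof.
elim: s a => [a|y s ih a] /=; first by rewrite ltxx.
move=> /andP[ay ys] _ /andP[ax xl].
have yl : y <= last y s.
  elim: s y ys {ih ay xl} => //= z s ih y /andP[yz zs].
  by rewrite (le_trans (ltW yz))// ih.
case: ifPn => [xy|]; first by exists a, y; rewrite lexx.
rewrite -ltNge => yx.
have [||p [q [yp px xq ql ->]]] := ih y ys; first exact: lt_le_trans yx xl.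
  by rewrite (ltW yx).
by exists p, q; rewrite (le_trans (ltW ay)).
Qed.

(** The half-open cells are disjoint and fill the half-open domain exactly, so the integral splits
    cell by cell, although F is evaluated on closed cells as in the Darboux sums. *)
Lemma integral_partition_step F a s : path <%R a s ->
  let t := nth (last a s) (a :: s) in
  (\int[mu]_(x in `]a, last a s]) (partition_step F a s x)%:E)%E =
  (\sum_(0 <= i < size s) F `[t i, t i.+1]%classic * (t i.+1 - t i))%:E.
Proof.
elim: s a => [a _|y s ih a] /=.
  by rewrite big_geq// set_itvoc0 integral_set0.
move=> /andP[ay ys]; rewrite big_nat_recl//= EFinD -ih//.
have yl : y <= last y s.
  elim: s y ys {ih ay} => //= z s ih y /andP[yz zs].
  by rewrite (le_trans (ltW yz))// ih.
have ae : `]a, last y s]%classic = `]a, y] `|` `]y, last y s].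
  by rewrite -itv_bndbnd_setU// bnd_simp ltW.
have disj : [disjoint `]a, y] & `]y, last y s]].
  apply/disj_setPS => x [] /=; rewrite !in_itv/= => /andP[_ xy] /andP[yx _].
  by move: (lt_le_trans yx xy); rewrite ltxx.
rewrite ae integral_setU//; last first.
  by apply/measurable_EFinP/measurable_funTS; exact: (measurable_partition_step F a (y :: s)).
congr (_ + _)%E.
  rewrite (eq_integral (cst (F `[a, y]%classic)%:E)); last first.
    by move=> x /set_mem /=; rewrite in_itv/= => /andP[_ ->].
  by rewrite integral_cst//= lebesgue_measure_itv/= lte_fin ay -EFinB -EFinM.
apply: eq_integral => x /set_mem /=; rewrite in_itv/= => /andP[yx _].
by rewrite leNgt yx.
Qed.

(** f is pinched between the supremum [h0] of lower step functions and the infimum [g0] of upper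
    ones. Both are Borel, and equality of the two Riemann integrals forces their difference to have
    integral 0, hence [h0 = f = g0] almost everywhere. *)
Lemma riemann_integrable_ae_measurable f a b c M : a < b ->
  (forall x, a <= x <= b -> c <= f x <= M) -> riemann_integrable f a b ->
  exists h, [/\ measurable_fun setT h, forall x, c <= h x <= M &
                {ae mu, forall x, `[a, b]%classic x -> f x = h x}].
Proof.
move=> ab fcM [_ LU].
(* L will be the common value of the lower and upper integrals, l and u Darboux sums within t of it,
   h and g the integrals of [h0] and [g0]. *)
have squeeze (eps L l h g u t : R) : L - t < l -> l <= h -> g <= u ->
  u < L + t -> t < eps / 2 -> g <= h + eps by lra.
have cM : c <= M.
  by have /andP[cf /(le_trans cf)] := fcM a (introT andP (conj (lexx a) (ltW ab))).
have fi p q x : a <= p -> p <= x -> x <= q -> q <= b ->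
    [/\ c <= inf (f @` `[p, q]), inf (f @` `[p, q]) <= f x,
        f x <= sup (f @` `[p, q]) & sup (f @` `[p, q]) <= M].
  move=> ap px xq qb.
  have pq y : `[p, q]%classic y -> c <= f y <= M.
    rewrite /= in_itv/= => /andP[py yq]; apply: fcM.
    by rewrite (le_trans ap py) (le_trans yq qb).
  have ne : f @` `[p, q] !=set0 by exists (f x), x => //=; rewrite in_itv/= px.
  have fx : (f @` `[p, q]) (f x) by exists x => //=; rewrite in_itv/= px.
  have lb : lbound (f @` `[p, q]) c by move=> _ [y /pq/andP[? _] <-].
  have ub : ubound (f @` `[p, q]) M by move=> _ [y /pq/andP[_ ?] <-].
  split; [exact: lb_le_inf|apply: ge_inf|apply: ub_le_sup|exact: ge_sup] => //.
    by exists c.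
  by exists M.
pose lo s := partition_step (fun I => inf (f @` I)) a s.
pose up s := partition_step (fun I => sup (f @` I)) a s.
have lo_bd s x : itv_partition a b s -> a <= x <= b -> c <= lo s x <= f x.
  move=> [ps /eqP ls] axb.
  have [||p [q [ap px xq]]] := @partition_stepP (fun I => inf (f @` I)) a s x ps.
  - by rewrite ls.
  - by rewrite ls.
  rewrite ls => qb; rewrite -/(lo _) => ->.
  by have [-> ->] := fi p q x ap px xq qb.
have up_bd s x : itv_partition a b s -> a <= x <= b -> f x <= up s x <= M.
  move=> [ps /eqP ls] axb.
  have [||p [q [ap px xq]]] := @partition_stepP (fun I => sup (f @` I)) a s x ps.
  - by rewrite ls.
  - by rewrite ls.
  rewrite ls => qb; rewrite -/(up _) => ->.
  by have [_ _ -> ->] := fi p q x ap px xq qb.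
pose D := `]a, b]%classic.
have Dab x : D x -> a <= x <= b by rewrite /D/= in_itv/= => /andP[/ltW -> ->].
have mD : measurable D by exact: measurable_itv.
have muD : (mu D < +oo)%E by rewrite /D lebesgue_measure_itv/= lte_fin ab ltry.
have int g : measurable_fun D g -> (forall x, a <= x <= b -> c <= g x <= M) ->
    mu.-integrable D (EFin \o g).
  move=> mg gcM; apply: measurable_bounded_integrable => //.
  exists (Num.max `|c| `|M|); split; first by rewrite num_real.
  move=> K cMK x /Dab/gcM /andP[cg gM] /=; apply: le_trans (ltW cMK).
  have Mn := ler_norm M; have := ler_norm (- c); rewrite normrN => cn.
  by rewrite le_max; case: (ger0P (g x)) => g0; apply/orP; [right|left]; lra.
have lo_int s : itv_partition a b s ->
    \int[mu]_(x in D) lo s x = darboux_lower_sum f a b s.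
  move=> [ps /eqP ls].
  have := @integral_partition_step (fun I => inf (f @` I)) a s ps.
  by rewrite /Rintegral ls => /= ->.
have up_int s : itv_partition a b s ->
    \int[mu]_(x in D) up s x = darboux_upper_sum f a b s.
  move=> [ps /eqP ls].
  have := @integral_partition_step (fun I => sup (f @` I)) a s ps.
  by rewrite /Rintegral ls => /= ->.
have mlo s : measurable_fun setT (lo s) by exact: measurable_partition_step.
have mup s : measurable_fun setT (up s) by exact: measurable_partition_step.
have ilo s : itv_partition a b s -> mu.-integrable D (EFin \o lo s).
  move=> ps; apply: int => [|x axb]; first exact: measurable_funTS.
  have /andP[-> lof] := lo_bd s x ps axb.
  by have /andP[_ fM] := fcM x axb; rewrite (le_trans lof).
have iup s : itv_partition a b s -> mu.-integrable D (EFin \o up s).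
  move=> ps; apply: int => [|x axb]; first exact: measurable_funTS.
  have /andP[fup ->] := up_bd s x ps axb.
  by have /andP[cf _] := fcM x axb; rewrite (le_trans cf).
have pab : itv_partition a b [:: b] by exact: itv_partition1.
pose e (n : nat) : R := n.+1%:R^-1.
have e0 n : 0 < e n by rewrite invr_gt0.
have /choice[s1 s1P] : forall n, exists s, itv_partition a b s /\
    lower_riemann_integral f a b - e n < \int[mu]_(x in D) lo s x.
  move=> n.
  have [|_ [s ps <-] le] :=
    @sup_adherent _ [set darboux_lower_sum f a b s | s in itv_partition a b] _ (e0 n).
    split; first by exists (darboux_lower_sum f a b [:: b]), [:: b].
    exists (\int[mu]_(x in D) up [:: b] x) => _ [s ps <-].
    rewrite -lo_int//; apply: le_Rintegral => //; [exact: ilo|exact: iup|].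
    move=> x /Dab axb; have /andP[_ lof] := lo_bd s x ps axb.
    by have /andP[fup _] := up_bd _ x pab axb; exact: le_trans lof fup.
  by exists s; split => //; rewrite lo_int.
have /choice[s2 s2P] : forall n, exists s, itv_partition a b s /\
    \int[mu]_(x in D) up s x < upper_riemann_integral f a b + e n.
  move=> n.
  have [|_ [s ps <-] le] :=
    @inf_adherent _ [set darboux_upper_sum f a b s | s in itv_partition a b] _ (e0 n).
    split; first by exists (darboux_upper_sum f a b [:: b]), [:: b].
    exists (\int[mu]_(x in D) lo [:: b] x) => _ [s ps <-].
    rewrite -up_int//; apply: le_Rintegral => //; [exact: ilo|exact: iup|].
    move=> x /Dab axb; have /andP[_ lof] := lo_bd _ x pab axb.
    by have /andP[fup _] := up_bd s x ps axb; exact: le_trans lof fup.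
  by exists s; split => //; rewrite up_int.
pose h0 x := sups (fun n => lo (s1 n) x) 0.
pose g0 x := infs (fun n => up (s2 n) x) 0.
have sdrop0 (u : R^nat) : sdrop u 0 = range u.
  by apply/seteqP; split => _ [n _ <-]; exists n.
have rub x : a <= x <= b -> ubound (range (fun n => lo (s1 n) x)) (f x).
  by move=> axb _ [n _ <-]; have /andP[] := lo_bd _ x (s1P n).1 axb.
have rlb x : a <= x <= b -> lbound (range (fun n => up (s2 n) x)) (f x).
  by move=> axb _ [n _ <-]; have /andP[] := up_bd _ x (s2P n).1 axb.
have h0f x : a <= x <= b -> h0 x <= f x.
  move=> axb; rewrite /h0/sups/= sdrop0; apply: ge_sup; last exact: rub.
  by exists (lo (s1 0%N) x), 0%N.
have loh0 n x : a <= x <= b -> lo (s1 n) x <= h0 x.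
  move=> axb; rewrite /h0/sups/= sdrop0; apply: ub_le_sup; last by exists n.
  by exists (f x); exact: rub.
have fg0 x : a <= x <= b -> f x <= g0 x.
  move=> axb; rewrite /g0/infs/= sdrop0; apply: lb_le_inf; last exact: rlb.
  by exists (up (s2 0%N) x), 0%N.
have g0up n x : a <= x <= b -> g0 x <= up (s2 n) x.
  move=> axb; rewrite /g0/infs/= sdrop0; apply: ge_inf; last by exists n.
  by exists (f x); exact: rlb.
have h0cM x : a <= x <= b -> c <= h0 x <= M.
  move=> axb; have /andP[_ fM] := fcM x axb.
  have /andP[clo _] := lo_bd _ x (s1P 0%N).1 axb.
  by rewrite (le_trans clo (loh0 _ _ axb)) (le_trans (h0f _ axb) fM).
have g0cM x : a <= x <= b -> c <= g0 x <= M.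
  move=> axb; have /andP[cf _] := fcM x axb.
  have /andP[_ upM] := up_bd _ x (s2P 0%N).1 axb.
  by rewrite (le_trans cf (fg0 _ axb)) (le_trans (g0up _ _ axb) upM).
have mh0 : measurable_fun `[a, b] h0.
  apply: measurable_fun_sups => [t|n]; last exact: measurable_funTS.
  by rewrite /= in_itv/= => /rub ?; exists (f t).
have mg0 : measurable_fun `[a, b] g0.
  apply: measurable_fun_infs => [t|n]; last exact: measurable_funTS.
  by rewrite /= in_itv/= => /rlb ?; exists (f t).
have Dsub : D `<=` `[a, b]%classic by move=> x /Dab; rewrite /= in_itv.
have mh0D : measurable_fun D h0 by exact: measurable_funS mh0.
have mg0D : measurable_fun D g0 by exact: measurable_funS mg0.
have igh : \int[mu]_(x in D) (g0 x - h0 x) = 0.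
  apply/eqP; rewrite eq_le Rintegral_ge0 ?andbT; last first.
    by move=> x /Dab axb; rewrite subr_ge0 (le_trans (h0f _ axb) (fg0 _ axb)).
  rewrite RintegralB//; [|exact: int|exact: int].
  rewrite subr_le0; apply/ler_addgt0Pr => eps eps0.
  have [n ne] : exists n, e n < eps / 2.
    have /ltr_add_invr[n] : 0 < eps / 2 by rewrite divr_gt0.
    by rewrite add0r => ne; exists n.
  have [p1 lo1] := s1P n; have [p2 up2] := s2P n.
  have : \int[mu]_(x in D) g0 x <= \int[mu]_(x in D) up (s2 n) x.
    by apply: le_Rintegral => //; [exact: int|exact: iup|move=> x /Dab/g0up].
  have : \int[mu]_(x in D) lo (s1 n) x <= \int[mu]_(x in D) h0 x.
    by apply: le_Rintegral => //; [exact: ilo|exact: int|move=> x /Dab/loh0].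
  rewrite LU in lo1 => loh gup.
  exact: (squeeze _ _ _ _ _ _ _ lo1 loh gup up2 ne).
have gh : ae_eq mu D (EFin \o (g0 \- h0)) (cst 0%E).
  apply/ae_eq_integral_abs => //.
    by apply/measurable_EFinP; exact: measurable_funB.
  transitivity (\int[mu]_(x in D) (g0 x - h0 x)%:E)%E.
    apply: eq_integral => x /set_mem/Dab axb /=; rewrite ger0_norm// subr_ge0.
    exact: (le_trans (h0f _ axb) (fg0 _ axb)).
  move: igh; rewrite /Rintegral => igh.
  rewrite -[LHS]fineK ?igh//.
  apply: integrable_fin_num => //.
  have -> : (fun x => (g0 x - h0 x)%:E) = ((EFin \o g0) \- (EFin \o h0))%E.
    by apply/funext => x; rewrite EFinB.
  by apply: integrableB => //; exact: int.
(* The value c outside [a, b] keeps the bounds, and with them positivity, valid on all of R. *)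
exists (fun x => if x \in `[a, b] then h0 x else c); split.
- apply: measurable_fun_if => //.
  + by under eq_fun do rewrite in_itv/=; apply: measurable_and; exact: measurable_fun_ler.
  + by rewrite setTI; apply: measurable_funS mh0.
- by move=> x; case: ifPn => [|_]; [rewrite in_itv/= => /h0cM|rewrite lexx].
(* The step functions were integrated over a half-open interval, so the left end point is discarded
   as a null set. *)
- have na : {ae mu, forall x : R, x != a}.
    exists [set a]; split => //; first exact: lebesgue_measure_set1.
    by move=> x /= /negP; rewrite negbK => /eqP.
  apply: filterS2 gh na => x gh xa /= xab; rewrite xab.
  have axb : a <= x <= b by rewrite in_itv in xab.
  have : D x.
    by move: axb => /andP[ax xb]; rewrite /D/= in_itv/= xb andbT lt_neqAle eq_sym xa.
  move=> /gh /= [] /eqP; rewrite subr_eq0 => /eqP g0h0.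
  apply/eqP; rewrite eq_le h0f// andbT -g0h0; exact: fg0.
Qed.

End riemann_borel.

(** * Poisson series *)

Section poisson_sums.
Context {R : realType}.
Implicit Types (u : R^nat) (f : (\bar R)^nat) (r : R).
Local Open Scope ereal_scope.

Lemma nneseriesS f : (forall k, 0 <= f k) ->
  \sum_(0 <= k <oo) f k = f 0%N + \sum_(0 <= k <oo) f k.+1.
Proof.
move=> f0; rewrite nneseries_recl//; congr +%E.
rewrite -nneseries_addn//; apply: eq_eseriesr => k _.
by rewrite addn1.
Qed.

(** The series of the theorem is a real [limn], which has some value even without convergence;
    finiteness of the extended sum guarantees that the two agree. *)
Lemma nneseries_cvgE u : (forall k, 0 <= u k)%R ->
  \sum_(0 <= k <oo) (u k)%:E < +oo ->
  \sum_(0 <= k <oo) (u k)%:E = (limn (series u))%:E.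
Proof.
move=> u0 /(nnseries_is_cvg u0) cu.
rewrite -EFin_lim//; congr (limn _); apply/funext => n.
by rewrite /series/= sumEFin.
Qed.

Lemma poisson_pmf_pos r k : (0 < r)%R ->
  poisson_pmf r k = (r ^+ k / k`!%:R * expR (- r))%R.
Proof. by rewrite /poisson_pmf => ->. Qed.

(** This trades a factor k for r after an index shift, so that the first two moments follow from the
    total mass. *)
Lemma poisson_pmfS r k : (0 < r)%R ->
  (k.+1%:R * poisson_pmf r k.+1 = r * poisson_pmf r k)%R.
Proof.
move=> r0; rewrite !poisson_pmf_pos// factS natrM exprS.
have k0 : (k.+1%:R != 0 :> R)%R by rewrite pnatr_eq0.
have f0 : (k`!%:R != 0 :> R)%R by rewrite pnatr_eq0 -lt0n fact_gt0.
move: (k.+1%:R)%R k0 => c c0; field; exact/andP.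
Qed.

Lemma sum_poisson_pmf r : (0 < r)%R ->
  \sum_(0 <= k <oo) (poisson_pmf r k)%:E = 1.
Proof.
move=> r0; have cr := @is_cvg_series_exp_coeff _ r.
transitivity (\sum_(0 <= k <oo) ((expR (- r))%:E * (exp_coeff r k)%:E)).
  apply: eq_eseriesr => k _.
  by rewrite poisson_pmf_pos// -EFinM mulrC.
rewrite nneseriesZl; last first.
  by move=> k _; rewrite lee_fin exp_coeff_ge0// ltW.
rewrite [X in _ * X](_ : _ = (expR r)%:E); last first.
  rewrite -EFin_lim//; congr (limn _); apply/funext => n.
  by rewrite /series/= sumEFin.
by rewrite -EFinM -expRD addNr expR0.
Qed.

Lemma sum_poisson_pmf1 r : (0 < r)%R ->
  \sum_(0 <= k <oo) (k%:R * poisson_pmf r k)%:E = r%:E.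
Proof.
move=> r0; rewrite nneseriesS; last first.
  by move=> k; rewrite lee_fin mulr_ge0 ?poisson_pmf_ge0.
rewrite mul0r add0e.
under eq_eseriesr do rewrite poisson_pmfS// EFinM.
rewrite nneseriesZl; last by move=> k _; rewrite lee_fin poisson_pmf_ge0.
by rewrite sum_poisson_pmf// mule1.
Qed.

Lemma sum_poisson_pmf2 r : (0 < r)%R ->
  \sum_(0 <= k <oo) (k%:R ^+ 2 * poisson_pmf r k)%:E = (r + r ^+ 2)%:E.
Proof.
move=> r0; rewrite nneseriesS; last first.
  by move=> k; rewrite lee_fin mulr_ge0 ?poisson_pmf_ge0// exprn_ge0.
rewrite expr0n mul0r add0e.
transitivity (\sum_(0 <= k <oo) (r%:E * ((k%:R * poisson_pmf r k)%:E +
    (poisson_pmf r k)%:E))).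
  apply: eq_eseriesr => k _; rewrite -EFinD -EFinM; congr EFin.
  by rewrite expr2 -mulrA poisson_pmfS// -natr1; ring.
rewrite nneseriesZl; last first.
  by move=> k _; rewrite -EFinD lee_fin addr_ge0 ?mulr_ge0 ?poisson_pmf_ge0.
rewrite nneseriesD; last 2 first.
- by move=> k _ _; rewrite lee_fin mulr_ge0 ?poisson_pmf_ge0.
- by move=> k _ _; rewrite lee_fin poisson_pmf_ge0.
rewrite sum_poisson_pmf// sum_poisson_pmf1//.
by rewrite -EFinD -EFinM; congr EFin; ring.
Qed.

(* The term k = 0 vanishes on the left because 0%:R^-1 = 0. *)
Lemma sum_poisson_pmfV r : (0 < r)%R ->
  \sum_(0 <= k <oo) (k%:R^-1 * poisson_pmf r k)%:E =
  (\big[+%R/0%R]_(1 <= k <oo) (k%:R^-1 * (expR (- r) * r ^+ k / k`!%:R)))%:E /\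
  (0 <= \big[+%R/0%R]_(1 <= k <oo)
     (k%:R^-1 * (expR (- r) * r ^+ k / k`!%:R)) <= 1 - expR (- r))%R.
Proof.
move=> r0.
have u0 k : (0 <= k%:R^-1 * poisson_pmf r k)%R.
  by rewrite mulr_ge0 ?poisson_pmf_ge0// invr_ge0.
(* Since [k%:R^-1 <= 1] for k >= 1, the sum is at most the Poisson mass outside 0. *)
have ule : \sum_(0 <= k <oo) (k%:R^-1 * poisson_pmf r k)%:E <=
    (1 - expR (- r))%:E.
  rewrite nneseriesS; last by move=> k; rewrite lee_fin.
  rewrite invr0 mul0r add0e.
  have := sum_poisson_pmf r0; rewrite nneseriesS; last first.
    by move=> k; rewrite lee_fin poisson_pmf_ge0.
  rewrite poisson_pmf_pos// expr0 fact0 divr1 mul1r => sum1.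
  rewrite EFinB leeBrDl// -sum1; apply: leeD => //.
  apply: lee_nneseries => k _; first by rewrite lee_fin.
  by rewrite lee_fin ler_piMl ?poisson_pmf_ge0// invf_le1// ler1n.
have E : limn (series (fun k => k%:R^-1 * poisson_pmf r k)%R) =
    (\big[+%R/0%R]_(1 <= k <oo) (k%:R^-1 * (expR (- r) * r ^+ k / k`!%:R)))%R.
  congr (limn _); apply/funext => -[|n]; first by rewrite /series/= !big_geq.
  rewrite /series/= big_ltn// invr0 mul0r add0r; apply: eq_bigr => k _.
  by rewrite poisson_pmf_pos//; ring.
have Ee := nneseries_cvgE u0 (le_lt_trans ule (ltry _)).
rewrite -E -Ee; split => //.
rewrite -!lee_fin -Ee ule andbT; apply: nneseries_ge0 => k _ _.
by rewrite lee_fin.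
Qed.

End poisson_sums.

(** * Moments of the bias of a root with given offspring moments *)

Section fibers.
Context d (T : measurableType d) (R : realType) (P : {measure set T -> \bar R}).
Context (N : T -> nat) (mN : measurable_fun setT N).

Lemma measurable_fiber n : measurable (N @^-1` [set n]).
Proof. by rewrite -[X in measurable X]setTI; exact: mN. Qed.

Lemma bigcup_fiber : \bigcup_n (N @^-1` [set n]) = setT.
Proof. by apply/seteqP; split => // t _; exists (N t). Qed.

Lemma trivIset_fiber : trivIset setT (fun n => N @^-1` [set n]).
Proof. by move=> i j _ _ [t /= [<- <-]]. Qed.

(** On each fiber of N the index is frozen, and there are countably many fibers. This covers sums
    with a random number of terms. *)
Lemma measurable_fun_fiber d' (T' : measurableType d') (F : nat -> T -> T') :
  (forall n, measurable_fun setT (F n)) -> measurable_fun setT (fun t => F (N t) t).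
Proof.
move=> mF _ B mB; rewrite setTI.
have -> : (fun t => F (N t) t) @^-1` B =
    \bigcup_n (N @^-1` [set n] `&` F n @^-1` B).
  by apply/seteqP; split => [t Bt|t [n _ [/= <-]]//]; exists (N t).
apply: bigcup_measurable => n _; apply: measurableI; first exact: measurable_fiber.
by rewrite -[X in measurable X]setTI; exact: mF.
Qed.

Local Open Scope ereal_scope.

Lemma ge0_integral_fiber (A : set T) (G : T -> \bar R) :
  measurable A -> measurable_fun A G -> (forall t, A t -> 0 <= G t) ->
  \int[P]_(t in A) G t =
  \sum_(0 <= n <oo) \int[P]_(t in A `&` N @^-1` [set n]) G t.
Proof.
move=> mA mG G0.
rewrite -[in LHS](setIT A) -bigcup_fiber setI_bigcupr ge0_integral_bigcup//.
- by move=> k; apply: measurableI => //; exact: measurable_fiber.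
- by rewrite -setI_bigcupr bigcup_fiber setIT.
- by move=> t; rewrite -setI_bigcupr => -[/G0].
- by apply: trivIset_setIl; exact: trivIset_fiber.
Qed.

Lemma ge0_integral_fun_fiber (A : set T) (g : nat -> R) :
  measurable A -> (forall n, 0 <= g n)%R ->
  \int[P]_(t in A) (g (N t))%:E =
  \sum_(0 <= n <oo) ((g n)%:E * P (A `&` N @^-1` [set n])).
Proof.
move=> mA g0; rewrite ge0_integral_fiber//; last 2 first.
- apply/measurable_EFinP/measurable_funTS.
  by apply: (@measurable_fun_fiber _ _ (fun n _ => g n)) => n; exact: measurable_cst.
- by move=> t _; rewrite lee_fin.
apply: eq_eseriesr => n _.
rewrite (eq_integral (cst (g n)%:E)); last by move=> t /set_mem[_ /= ->].
by rewrite integral_cst//; apply: measurableI => //; exact: measurable_fiber.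
Qed.

End fibers.

Section bias_moments.
Context d (T : measurableType d) (R : realType) (P : probability T R).
Context (N : T -> nat) (mN : measurable_fun setT N).
Context (Y : nat -> T -> R) (mY : forall j, measurable_fun setT (Y j)).
Context (Y0 : forall j t, 0 <= Y j t).
Context (p : nat -> R) (m1 m2 M1 M2 S : R).
Hypothesis pE : forall n, P (N @^-1` [set n]) = (p n)%:E.
Hypothesis M1E : (\sum_(0 <= n <oo) (n%:R * p n)%:E = M1%:E)%E.
Hypothesis M2E : (\sum_(0 <= n <oo) (n%:R ^+ 2 * p n)%:E = M2%:E)%E.
Hypothesis SE : (\sum_(0 <= n <oo) (n%:R^-1 * p n)%:E = S%:E)%E.
(** The variance [m2 - m1 ^+ 2] becomes a coefficient in a series that is split as an extended real
    sum of nonnegative terms. *)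
Hypothesis m12 : m1 ^+ 2 <= m2.
(** Here and in [m2E], independence of the Y j from N and from each other is expressed as a product
    form of integrals over the fibers of N. *)
Hypothesis m1E : forall n j,
  (\int[P]_(t in N @^-1` [set n]) (Y j t)%:E = (p n * m1)%:E)%E.
Hypothesis m2E : forall n i j,
  (\int[P]_(t in N @^-1` [set n]) (Y i t * Y j t)%:E =
   (p n * (if i == j then m2 else m1 ^+ 2))%:E)%E.

Let p_ge0 n : 0 <= p n.
Proof. by rewrite -lee_fin -pE. Qed.

(** The weight [(n != 0%N)%:R] is what [n%:R^-1 * n%:R] amounts to; the sum is the probability that
    the root has a child. *)
Let sum_p : (\sum_(0 <= n <oo) ((n != 0%N)%:R * p n)%:E = (1 - p 0%N)%:E)%E.
Proof.
have : (\sum_(0 <= n <oo) (p n)%:E = 1)%E.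
  rewrite -(probability_setT P) -(bigcup_fiber N) measure_bigcup//.
  - rewrite [RHS](@eq_eseriesl _ _ xpredT); first by apply: eq_eseriesr => n _; exact/esym/pE.
    by move=> n; rewrite in_setT.
  - by move=> n _; exact: measurable_fiber.
  - by apply: trivIset_fiber.
rewrite nneseriesS => [sum1|k]; last by rewrite lee_fin.
rewrite nneseriesS => [|k]; last by rewrite lee_fin mulr_ge0.
rewrite mul0r add0e; under eq_eseriesr do rewrite mul1r.
move: sum1; rewrite EFinB => <-.
by rewrite addeAC subee// add0e.
Qed.

Let mean_child t : R := (N t)%:R^-1 * \sum_(j < N t) Y j t.

Let mmean_child : measurable_fun setT mean_child.
Proof.
apply: (@measurable_fun_fiber _ _ _ mN _ _ (fun n t => n%:R^-1 * \sum_(j < n) Y j t)).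
move=> n; apply: measurable_funM; first exact: measurable_cst.
exact: measurable_sum.
Qed.

Let mean_child_ge0 t : 0 <= mean_child t.
Proof. by rewrite mulr_ge0 ?invr_ge0// sumr_ge0. Qed.

Let mNR : measurable_fun setT (fun t => (N t)%:R : R).
Proof.
by apply: (@measurable_fun_fiber _ _ _ mN _ _ (fun n _ => n%:R : R)) => n; exact: measurable_cst.
Qed.

Local Open Scope ereal_scope.

Let mfib n : measurable (N @^-1` [set n]) := measurable_fiber mN n.

Let mY_fib j n : measurable_fun (N @^-1` [set n]) (EFin \o Y j).
Proof. by apply/measurable_EFinP/measurable_funTS. Qed.

Let fiber_sum n :
  \int[P]_(t in N @^-1` [set n]) (\sum_(j < n) Y j t)%:E = (n%:R * p n * m1)%:E.
Proof.
under eq_integral do rewrite -sumEFin.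
rewrite ge0_integral_sum//.
- under eq_bigr do rewrite m1E.
  by rewrite sumEFin sumr_const card_ord; congr EFin; ring.
- by move=> j; exact: mY_fib.
- by move=> j t _; rewrite lee_fin.
Qed.

(** Of the n^2 products, n are diagonal with second moment m2 and the others contribute [m1 ^+ 2];
    the terms are regrouped so that the variance appears. *)
Let fiber_sum2 n :
  \int[P]_(t in N @^-1` [set n]) ((\sum_(j < n) Y j t) ^+ 2)%:E =
  (p n * (n%:R * (m2 - m1 ^+ 2) + n%:R ^+ 2 * m1 ^+ 2))%:E.
Proof.
have sqE t : ((\sum_(j < n) Y j t) ^+ 2)%:E =
    \sum_(i < n) \sum_(j < n) (Y i t * Y j t)%:E.
  under [RHS]eq_bigr do rewrite sumEFin.
  rewrite sumEFin expr2 mulr_suml; congr EFin.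
  by apply: eq_bigr => i _; rewrite mulr_sumr.
under eq_integral do rewrite sqE.
have mYY i j : measurable_fun (N @^-1` [set n]) (fun t => (Y i t * Y j t)%:E).
  by apply/measurable_EFinP/measurable_funTS; exact: measurable_funM.
rewrite ge0_integral_sum//; last 2 first.
- move=> i; apply: emeasurable_sum => j; exact: mYY.
- by move=> i t _; apply: sume_ge0 => j _; rewrite lee_fin mulr_ge0.
transitivity (\sum_(i < n) (p n * ((m2 - m1 ^+ 2) + n%:R * m1 ^+ 2))%:E).
  apply: eq_bigr => i _; rewrite ge0_integral_sum//; last first.
    by move=> j t _; rewrite lee_fin mulr_ge0.
  under eq_bigr do rewrite m2E.
  rewrite sumEFin -mulr_sumr; congr (_ * _)%:E.
  rewrite (bigD1 i)//= eqxx.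
  rewrite (eq_bigr (fun=> m1 ^+ 2)%R); last first.
    by move=> j; rewrite -val_eqE/= eq_sym => /negbTE ->.
  rewrite sumr_const cardC1 card_ord -mulr_natl.
  have n0 : (0 < n)%N by exact: leq_ltn_trans (ltn_ord i).
  by rewrite -{2}(prednK n0) -natr1; ring.
by rewrite sumEFin sumr_const card_ord -mulr_natl; congr EFin; ring.
Qed.

(** Common scheme of the five expectations below: on [N = n] the integrand is a constant [a n] times
    [H n]. The separate sequence c lets the term n = 0, where an inverse may degenerate, be
    simplified by the caller. *)
Let fiber_sumE (G : T -> R) (H : nat -> T -> R) (a b c : R^nat) :
  measurable_fun setT G -> (forall t, 0 <= G t)%R ->
  (forall n, measurable_fun setT (H n)) -> (forall n t, 0 <= H n t)%R ->
  (forall n, 0 <= a n)%R ->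
  (forall n t, N t = n -> G t = a n * H n t)%R ->
  (forall n, \int[P]_(t in N @^-1` [set n]) (H n t)%:E = (b n)%:E) ->
  (forall n, a n * b n = c n)%R ->
  \int[P]_t (G t)%:E = \sum_(0 <= n <oo) (c n)%:E.
Proof.
move=> mG G0 mH H0 a0 GH Hb abc.
rewrite (ge0_integral_fiber P mN)//; last 2 first.
- exact/measurable_EFinP.
- by move=> t _; rewrite lee_fin.
apply: eq_eseriesr => n _; rewrite setTI.
transitivity (\int[P]_(t in N @^-1` [set n]) ((a n)%:E * (H n t)%:E)).
  by apply: eq_integral => t /set_mem /= /GH ->.
rewrite ge0_integralZl_EFin//; last 2 first.
- by move=> t _; rewrite lee_fin.
- exact/measurable_EFinP/measurable_funTS.
by rewrite Hb -EFinM abc.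
Qed.

Let msum n : measurable_fun setT (fun t => \sum_(j < n) Y j t)%R.
Proof. exact: measurable_sum. Qed.

Let sum_ge0 n t : (0 <= \sum_(j < n) Y j t)%R.
Proof. exact: sumr_ge0. Qed.

Let seriesZ (c : R) (u : R^nat) (s : R) : (forall n, 0 <= u n)%R ->
  \sum_(0 <= n <oo) (u n)%:E = s%:E ->
  \sum_(0 <= n <oo) (c * u n)%:E = (c * s)%:E.
Proof.
move=> u0 us; under eq_eseriesr do rewrite EFinM.
by rewrite nneseriesZl ?us// => n _; rewrite lee_fin.
Qed.

Let E_mean_child : \int[P]_t (mean_child t)%:E = (m1 * (1 - p 0%N))%:E.
Proof.
rewrite (fiber_sumE (H := fun n t => (\sum_(j < n) Y j t)%R) (a := fun n => (n%:R^-1)%R)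
  (b := fun n => (n%:R * p n * m1)%R) (c := fun n => (m1 * ((n != 0%N)%:R * p n))%R))//.
- by apply: seriesZ => // n; rewrite mulr_ge0.
- by move=> n t <-.
- move=> n; have [->|n0] := eqVneq n 0%N; first by rewrite /= !(mul0r, mulr0).
  by rewrite -!mulrA mulKf ?pnatr_eq0//=; ring.
Qed.

Let E_mean_childN :
  \int[P]_t ((N t)%:R * mean_child t)%:E = (m1 * M1)%:E.
Proof.
rewrite (fiber_sumE (H := fun n t => (\sum_(j < n) Y j t)%R) (a := fun n => (n%:R / n%:R)%R)
  (b := fun n => (n%:R * p n * m1)%R) (c := fun n => (m1 * (n%:R * p n))%R))//.
- by apply: seriesZ => // n; rewrite mulr_ge0.
- exact: measurable_funM.
- by move=> t; exact: mulr_ge0.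
- by move=> n t <-; rewrite -mulrA.
- move=> n; have [->|n0] := eqVneq n 0%N; first by rewrite /= !(mul0r, mulr0).
  by rewrite divff ?pnatr_eq0//; ring.
Qed.

Let E_mean_child2 : \int[P]_t (mean_child t ^+ 2)%:E =
  ((m2 - m1 ^+ 2) * S + m1 ^+ 2 * (1 - p 0%N))%:E.
Proof.
rewrite (fiber_sumE (H := fun n t => ((\sum_(j < n) Y j t) ^+ 2)%R)
  (a := fun n => (n%:R ^- 2)%R)
  (b := fun n => (p n * (n%:R * (m2 - m1 ^+ 2) + n%:R ^+ 2 * m1 ^+ 2))%R)
  (c := fun n => ((m2 - m1 ^+ 2) * (n%:R^-1 * p n) +
                 m1 ^+ 2 * ((n != 0%N)%:R * p n))%R))//.
- rewrite [RHS]EFinD -(@seriesZ (m2 - m1 ^+ 2) _ _ _ SE); last first.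
    by move=> n; rewrite mulr_ge0 ?invr_ge0.
  rewrite -(@seriesZ (m1 ^+ 2) _ _ _ sum_p); last by move=> n; rewrite mulr_ge0.
  under eq_eseriesr do rewrite EFinD.
  rewrite nneseriesD// => n _ _; rewrite lee_fin; apply: mulr_ge0.
  - by rewrite subr_ge0.
  - by rewrite mulr_ge0 ?invr_ge0.
  - exact: sqr_ge0.
  - exact: mulr_ge0.
- exact: measurable_funX.
- by move=> t; rewrite sqr_ge0.
- by move=> n; exact: measurable_funX.
- by move=> n t; rewrite sqr_ge0.
- by move=> n t <-; rewrite exprMn exprVn.
- move=> n; have [->|n0] := eqVneq n 0%N.
    by rewrite /= expr0n/= !(mul0r, mulr0, invr0, addr0).
  have : (n%:R != 0 :> R)%R by rewrite pnatr_eq0.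
  by move: (n%:R)%R => c c0 /=; field.
Qed.

Let EN : \int[P]_t ((N t)%:R : R)%:E = M1%:E.
Proof.
rewrite (fiber_sumE (H := fun n t => 1%R) (a := fun n => (n%:R)%R)
  (b := p) (c := fun n => (n%:R * p n)%R))//.
- by move=> n t <-; rewrite mulr1.
- by move=> n; rewrite integral_cst// mul1e; exact: pE.
Qed.

Let EN2 : \int[P]_t ((N t)%:R ^+ 2 : R)%:E = M2%:E.
Proof.
rewrite (fiber_sumE (H := fun n t => 1%R) (a := fun n => (n%:R ^+ 2)%R)
  (b := p) (c := fun n => (n%:R ^+ 2 * p n)%R))//.
- exact: measurable_funX.
- by move=> n t <-; rewrite mulr1.
- by move=> n; rewrite integral_cst// mul1e; exact: pE.
Qed.

Let integrable_ge0 (G : T -> R) (e : R) : measurable_fun setT G ->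
  (forall t, 0 <= G t)%R -> \int[P]_t (G t)%:E = e%:E ->
  P.-integrable setT (EFin \o G).
Proof.
move=> mG G0 Ge; apply/integrableP; split; first exact/measurable_EFinP.
rewrite (eq_integral (EFin \o G)); last by move=> t _; rewrite /= ger0_norm.
by rewrite Ge ltry.
Qed.

Lemma bias_mean :
  \int[P]_t ((N t)%:R^-1 * \sum_(j < N t) Y j t - (N t)%:R)%:E =
  (m1 * (1 - p 0%N) - M1)%:E.
Proof.
under eq_integral do rewrite EFinB.
rewrite integralB//.
- by rewrite E_mean_child EN.
- exact: integrable_ge0 E_mean_child.
- exact: integrable_ge0 EN.
Qed.

Lemma bias_second_moment :
  \int[P]_t (((N t)%:R^-1 * \sum_(j < N t) Y j t - (N t)%:R) ^+ 2)%:E =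
  ((m2 - m1 ^+ 2) * S + m1 ^+ 2 * (1 - p 0%N) + M2 - 2 * (m1 * M1))%:E.
Proof.
(* The square of the bias is F - G with both parts nonnegative, so each is integrated without
   integrability conditions and one subtraction of finite values remains. *)
pose F t : R := (mean_child t ^+ 2 + (N t)%:R ^+ 2)%R.
pose G t : R := (2 * ((N t)%:R * mean_child t))%R.
have mG : measurable_fun setT G by do 2 apply: measurable_funM => //.
have mF : measurable_fun setT F.
  by apply: measurable_funD; exact: measurable_funX.
have F0 t : (0 <= F t)%R by rewrite addr_ge0 ?sqr_ge0.
have G0 t : (0 <= G t)%R by rewrite !mulr_ge0.
have EF : \int[P]_t (F t)%:E =
    ((m2 - m1 ^+ 2) * S + m1 ^+ 2 * (1 - p 0%N) + M2)%:E.
  under eq_integral do rewrite EFinD.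
  rewrite ge0_integralD//.
  - by rewrite E_mean_child2 EN2.
  - by move=> t _; rewrite lee_fin sqr_ge0.
  - by apply/measurable_EFinP; exact: measurable_funX.
  - by apply/measurable_EFinP; exact: measurable_funX.
have EG : \int[P]_t (G t)%:E = (2 * (m1 * M1))%:E.
  under eq_integral do rewrite EFinM.
  rewrite ge0_integralZl_EFin//; first by rewrite E_mean_childN.
  - by move=> t _; rewrite lee_fin mulr_ge0.
  - by apply/measurable_EFinP; exact: measurable_funM.
transitivity (\int[P]_t ((F t)%:E - (G t)%:E)).
  by apply: eq_integral => t _; rewrite -EFinB; congr EFin; rewrite /F /G /mean_child; ring.
rewrite integralB//.
- by rewrite EF EG.
- exact: integrable_ge0 EF.
- exact: integrable_ge0 EG.
Qed.

End bias_moments.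

(** * Independence of the offspring counts *)

Section independent_counts.
Context d (T : measurableType d) (R : realType) (P : probability T R).
Context (I : choiceType) (X : I -> {RV P >-> R}) (D : I -> {RV P >-> nat}).
Hypothesis indep : mutually_independent P (fun v (t : T) => (X v t, D v t)).
Local Open Scope ereal_scope.

Let count (v : I) (n : nat) : set T := D v @^-1` [set n].

Lemma measurable_count v n : measurable (count v n).
Proof. exact: (measurable_fiber (measurable_funPT (D v)) n). Qed.

(** The independence of the pairs is applied to rectangles whose type side is all of R, which leaves
    the counts alone. Distinct labels are needed to turn the finite set into a list without changing
    the product. *)
Lemma independent_counts (s : seq I) (c : I -> nat) : uniq s ->
  P (\bigcap_(v in [set` s]) count v (c v)) = \prod_(v <- s) P (count v (c v)).
Proof.
move=> us; have mA v : measurable ([set: R] `*` [set c v]) by exact: measurableX.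
have := indep [fset v in s]%fset mA.
have pre v : (fun t : T => (X v t, D v t)) @^-1` ([set: R] `*` [set c v]) = count v (c v).
  by apply/seteqP; split => [t []|t].
rewrite (eq_bigr (fun v => P (count v (c v)))) => [|v _]; last by rewrite pre.
rewrite (perm_big s)/=; last first.
  by apply: uniq_perm => // v; rewrite in_fset.
move=> <-; congr (P _); apply/seteqP; split=> t tc v vs.
  by rewrite pre; apply: tc; move: vs; rewrite /= in_fset.
by rewrite -pre; apply: tc; rewrite /= in_fset.
Qed.

Lemma independent_counts3 u v w (k l m : nat) : uniq [:: u; v; w] ->
  P (count u k `&` count v l `&` count w m) =
  P (count u k) * P (count v l) * P (count w m).
Proof.
move=> us; pose c x := if x == u then k else if x == v then l else m.
have [cu cv cw] : [/\ c u = k, c v = l & c w = m].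
  move: us; rewrite /= !inE negb_or /c => /and3P[/andP[uv uw] vw _].
  by rewrite !eqxx ![_ == u]eq_sym [w == v]eq_sym !ifN.
have := independent_counts c us.
rewrite !big_cons big_nil mule1 cu cv cw muleA => <-.
congr (P _); apply/seteqP; split => t.
  by move=> [[uk vl] wm] x; rewrite /= !inE => /or3P[] /eqP ->; rewrite ?cu ?cv ?cw.
move=> tc; split; first split.
- by rewrite -cu; apply: tc; rewrite /= !inE eqxx.
- by rewrite -cv; apply: tc; rewrite /= !inE eqxx orbT.
- by rewrite -cw; apply: tc; rewrite /= !inE eqxx !orbT.
Qed.

Lemma independent_counts2 u v (k l : nat) : u != v ->
  P (count u k `&` count v l) = P (count u k) * P (count v l).
Proof.
move=> uv; pose c x := if x == u then k else l.
have [cu cv] : c u = k /\ c v = l by rewrite /c eqxx eq_sym ifN.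
have := @independent_counts [:: u; v] c; rewrite /= inE uv => /(_ isT).
rewrite !big_cons big_nil mule1 cu cv => <-.
congr (P _); apply/seteqP; split => t.
  by move=> [uk vl] x; rewrite /= !inE => /orP[] /eqP ->; rewrite ?cu ?cv.
move=> tc; split.
- by rewrite -cu; apply: tc; rewrite /= !inE eqxx.
- by rewrite -cv; apply: tc; rewrite /= !inE eqxx orbT.
Qed.

Context (p : I -> nat -> R) (pE : forall v n, P (count v n) = (p v n)%:E).

(** Slicing the event along the values of [D v] turns the integral into a series of probabilities
    that factor. With u the root and v a child it yields the first moments and the diagonal second
    moments. *)
Lemma integral_count1 u v n (g : nat -> R) (e : R) : u != v ->
  (forall k, 0 <= g k)%R -> \sum_(0 <= k <oo) (g k * p v k)%:E = e%:E ->
  \int[P]_(t in count u n) (g (D v t))%:E = (p u n * e)%:E.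
Proof.
move=> uv g0 ge; rewrite ge0_integral_fun_fiber//; last exact: measurable_count.
rewrite EFinM -ge -nneseriesZl; last first.
  by move=> k _; rewrite lee_fin mulr_ge0// -lee_fin -pE.
apply: eq_eseriesr => k _; rewrite [X in _ * X]independent_counts2// !pE.
by rewrite -!EFinM; congr EFin; ring.
Qed.

(** The cross terms: the event is sliced along [D v] and then along [D w], and the three counts are
    independent. *)
Lemma integral_count2 u v w n (g h : nat -> R) (e e' : R) : uniq [:: u; v; w] ->
  (forall k, 0 <= g k)%R -> (forall k, 0 <= h k)%R ->
  \sum_(0 <= k <oo) (g k * p v k)%:E = e%:E ->
  \sum_(0 <= k <oo) (h k * p w k)%:E = e'%:E ->
  \int[P]_(t in count u n) (g (D v t) * h (D w t))%:E = (p u n * (e * e'))%:E.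
Proof.
move=> us g0 h0 ge he.
have p0 x k : (0 <= p x k)%R by rewrite -lee_fin -pE.
have mD x (k : nat -> R) : measurable_fun setT (fun t => k (D x t)).
  apply: (@measurable_fun_fiber _ _ _ (measurable_funPT (D x)) _ _ (fun n _ => k n)) => m.
  exact: measurable_cst.
rewrite (ge0_integral_fiber P (measurable_funPT (D v))); last 3 first.
- exact: measurable_count.
- by apply/measurable_EFinP/measurable_funTS/measurable_funM; exact: mD.
- by move=> t _; rewrite lee_fin mulr_ge0.
transitivity (\sum_(0 <= k <oo) ((p u n * e')%:E * (g k * p v k)%:E)); last first.
  rewrite nneseriesZl; last by move=> k _; rewrite lee_fin mulr_ge0.
  by rewrite ge -EFinM; congr EFin; ring.
apply: eq_eseriesr => k _.
have muv : measurable (count u n `&` count v k).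
  by apply: measurableI; exact: measurable_count.
transitivity (\int[P]_(t in count u n `&` count v k) ((g k)%:E * (h (D w t))%:E)).
  by apply: eq_integral => t /set_mem [_ /= ->].
rewrite ge0_integralZl_EFin//; last 2 first.
- by move=> t _; rewrite lee_fin.
- by apply/measurable_EFinP/measurable_funTS; exact: mD.
rewrite ge0_integral_fun_fiber//.
transitivity ((g k)%:E * \sum_(0 <= l <oo) ((p u n * p v k)%:E * (h l * p w l)%:E)).
  congr (_ * _); apply: eq_eseriesr => l _.
  rewrite [X in _ * X]independent_counts3// !pE.
  by rewrite -!EFinM; congr EFin; ring.
rewrite nneseriesZl; last by move=> l _; rewrite lee_fin mulr_ge0.
by rewrite he -!EFinM; congr EFin; ring.
Qed.

End independent_counts.

(** * The kernel and its moments *)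

Section kernel_representative.
Context {R : realType}.
Local Notation mu := (@lebesgue_measure R).
Local Notation I01 := (`[0, 1]%classic : set R).

Lemma kernel_bounds (f : R -> R) : kernel_class f ->
  exists c M : R, 0 < c /\ forall x, 0 <= x <= 1 -> c <= f x <= M.
Proof.
move=> [f0 _ _ infe supe].
(* One point of [0, 1] suffices to exclude an infimum [+oo] and a supremum [-oo]. *)
have I0 : (0 : R) \in `[0, 1] by rewrite in_itv/= lexx ler01.
have inf_le x : x \in `[0, 1] ->
    (ereal_inf [set (f x)%:E | x in `[0%R, 1%R]] <= (f x)%:E)%E.
  by move=> x01; apply: ereal_inf_lbound; exists x.
have sup_ge x : x \in `[0, 1] ->
    ((f x)%:E <= ereal_sup [set (f x)%:E | x in `[0%R, 1%R]])%E.
  by move=> x01; apply: ereal_sup_ubound; exists x.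
move: infe inf_le; case: (ereal_inf _) => [c|_ /(_ _ I0)|]//.
rewrite lte_fin => c0 cf; move: supe sup_ge; case: (ereal_sup _) => [M||_ /(_ _ I0)]// _ fM.
exists c, M; split => // x x01.
by have x01' : x \in `[0, 1] by []; rewrite -!lee_fin cf// fM.
Qed.

Lemma kernel_ae_measurable (f : R -> R) : kernel_class f ->
  exists (h : R -> R) (c M : R), [/\ 0 < c, forall x, c <= h x <= M, measurable_fun setT h &
    {ae mu, forall x, I01 x -> f x = h x}].
Proof.
move=> hf; have [c [M [c0 fcM]]] := kernel_bounds hf.
have [h [mh hcM fh]] :=
  riemann_integrable_ae_measurable ltr01 fcM (kernel_riemann hf).
by exists h, c, M.
Qed.

End kernel_representative.

Section kernel_moments.
Context {R : realType} (f h : R -> R) (c M : R).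
Local Notation mu := (@lebesgue_measure R).
Local Notation I01 := (`[0, 1]%classic : set R).
Hypothesis f_gt0 : forall x, x \in `[0, 1] -> 0 < f x.
Hypothesis c0 : 0 < c.
Hypothesis hcM : forall x, c <= h x <= M.
Hypothesis mh : measurable_fun setT h.
Hypothesis fh : {ae mu, forall x, I01 x -> f x = h x}.

Lemma rep_gt0 x : 0 < h x.
Proof. by have /andP[+ _] := hcM x; exact: lt_le_trans. Qed.
Hint Resolve rep_gt0 : core.

(** Serves for powers, exponentials and the Poisson series: all are nonnegative at positive
    arguments, where f on [0, 1] and h take their values. *)
Lemma ge0_integral_rep (phi : R -> \bar R) :
  (forall x, 0 < x -> (0 <= phi x)%E) ->
  (\int[mu]_(x in I01) phi (f x) = \int[mu]_(x in I01) phi (h x))%E.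
Proof.
move=> phi0; apply: ge0_eq_integral_ae.
- by move=> x x01; apply/phi0/f_gt0.
- by move=> x _; exact: phi0.
- have [N [mN N0 fhN]] := fh; exists N; split=> //.
  by apply: subset_trans fhN; apply: subsetC => x xh /xh ->.
Qed.

Lemma lebesgue_measure01 : mu I01 = 1%E.
Proof. by rewrite lebesgue_measure_itv/= lte_fin ltr01 oppr0 adde0. Qed.

Lemma integrable_rep (phi : R -> R) (K : R) : measurable_fun setT phi ->
  (forall x, c <= x <= M -> `|phi x| <= K) ->
  mu.-integrable I01 (EFin \o (phi \o h)).
Proof.
move=> mphi phiK; apply: measurable_bounded_integrable => //.
- by rewrite /= lebesgue_measure01 ltry.
- by apply: measurable_funTS; exact: measurableT_comp.
- exists K; split; first by rewrite num_real.
  by move=> y Ky x _ /=; rewrite (le_trans (phiK _ (hcM x)))// ltW.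
Qed.

Lemma integrable_repX m : mu.-integrable I01 (fun x => (h x ^+ m)%:E).
Proof.
apply: (@integrable_rep (fun x => x ^+ m) (M ^+ m)).
  by apply: measurable_funX.
move=> x /andP[cx xM]; have x0 := ltW (lt_le_trans c0 cx).
by rewrite ger0_norm ?exprn_ge0// lerXn2r// nnegrE (le_trans x0).
Qed.

Lemma beta_rep m : (beta f m)%:E = (\int[mu]_(x in I01) (h x ^+ m)%:E)%E.
Proof.
rewrite /beta /Rintegral (@ge0_integral_rep (fun y => (y ^+ m)%:E)).
  by rewrite fineK//; apply: integrable_fin_num => //; exact: integrable_repX.
by move=> x x0; rewrite lee_fin exprn_ge0// ltW.
Qed.

(** Three terms suffice for every polynomial in h integrated below; shorter ones are padded with
    zero coefficients. *)
Lemma integral_rep3 (a1 a2 a3 : R) (i j k : nat) :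
  (\int[mu]_(x in I01) (a1 * h x ^+ i + a2 * h x ^+ j + a3 * h x ^+ k)%:E)%E =
  (a1 * beta f i + a2 * beta f j + a3 * beta f k)%:E.
Proof.
have ih a m : mu.-integrable I01 (fun x => (a%:E * (h x ^+ m)%:E)%E).
  by apply: integrableZl => //; exact: integrable_repX.
under eq_integral do rewrite !EFinD !EFinM.
rewrite integralD//; last exact: integrableD.
rewrite integralD// !integralZl//; [|exact: integrable_repX..].
by rewrite -!beta_rep !EFinD !EFinM.
Qed.

Lemma beta0 : beta f 0 = 1.
Proof.
apply: EFin_inj; rewrite beta_rep.
under eq_integral do rewrite expr0.
by rewrite integral_cst//= mul1e lebesgue_measure01.
Qed.

Lemma beta_ge m : c ^+ m <= beta f m.
Proof.
rewrite -lee_fin beta_rep -[leLHS]mule1 -lebesgue_measure01 -integral_cst//.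
apply: ge0_le_integral_ae.
- by move=> x _; rewrite lee_fin exprn_ge0// ltW.
- by move=> x _; rewrite lee_fin exprn_ge0// ltW.
- apply: aeW => x _; have /andP[cx _] := hcM x.
  by rewrite lee_fin lerXn2r// nnegrE ltW.
Qed.

Lemma beta_gt0 m : 0 < beta f m.
Proof. by apply: lt_le_trans (beta_ge m); rewrite exprn_gt0. Qed.

Lemma integral_rep_square t m :
  (\int[mu]_(x in I01) ((h x - t) ^+ 2 * h x ^+ m)%:E)%E =
  (beta f m.+2 - 2 * t * beta f m.+1 + t ^+ 2 * beta f m)%:E.
Proof.
transitivity (\int[mu]_(x in I01)
    (1 * h x ^+ m.+2 + (- (2 * t)) * h x ^+ m.+1 + t ^+ 2 * h x ^+ m)%:E)%E.
  by apply: eq_integral => x _; congr EFin; rewrite !exprS; ring.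
by rewrite integral_rep3; congr EFin; ring.
Qed.

(** At its minimiser [t = beta f m.+1 / beta f m] this quadratic gives the Cauchy-Schwarz inequality
    for three consecutive moments; m = 0 and m = 1 are the two cases used. *)
Lemma beta_square_ge0 t m :
  0 <= beta f m.+2 - 2 * t * beta f m.+1 + t ^+ 2 * beta f m.
Proof.
rewrite -lee_fin -integral_rep_square; apply: integral_ge0 => x _.
by rewrite lee_fin mulr_ge0 ?sqr_ge0// exprn_ge0// ltW.
Qed.

Lemma beta1_sqr_le : beta f 1 ^+ 2 <= beta f 2.
Proof.
have := beta_square_ge0 (beta f 1) 0; rewrite beta0.
by move: (beta f 1) (beta f 2) => b1 b2; nra.
Qed.

Lemma beta2_sqr_le : beta f 2 ^+ 2 <= beta f 1 * beta f 3.
Proof.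
have := beta_square_ge0 (beta f 2 / beta f 1) 1; have := beta_gt0 1.
move: (beta f 1) (beta f 2) (beta f 3) => b1 b2 b3 b10 b3_ge.
have -> : b2 ^+ 2 = b1 * (b2 ^+ 2 / b1) by field; rewrite gt_eqF.
rewrite ler_pM2l// -subr_ge0; congr (0 <= _): b3_ge.
by field; rewrite gt_eqF.
Qed.

(** In the case of equality the square of [h - beta f 1] integrates to 0, so h, and with it f, is
    almost everywhere equal to [beta f 1]. *)
Lemma beta1_sqr_lt : ~ ae_constant f -> beta f 1 ^+ 2 < beta f 2.
Proof.
move=> nc; rewrite lt_neqAle beta1_sqr_le andbT; apply/eqP => b12; apply: nc.
exists (beta f 1).
have := integral_rep_square (beta f 1) 0.
rewrite beta0 (_ : (_ - _ + _)%R = 0); last by rewrite -b12; ring.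
move=> sq0.
have : ae_eq mu I01 (fun x => ((h x - beta f 1) ^+ 2 * h x ^+ 0)%:E) (cst 0%E).
  apply/ae_eq_integral_abs => //.
    apply/measurable_EFinP/measurable_funTS/measurable_funM => //.
    by apply: measurable_funX; exact: measurable_funB.
  rewrite -[RHS]sq0; apply: eq_integral => x _.
  by rewrite gee0_abs// lee_fin mulr_ge0 ?sqr_ge0.
move=> sq; apply: (negligibleS _ (negligibleU fh sq)).
rewrite -setCI; apply: subsetC => x [xh xsq] x01; rewrite xh//.
have [] := xsq x01; rewrite expr0 mulr1 => /eqP.
by rewrite sqrf_eq0 subr_eq0 => /eqP.
Qed.

End kernel_moments.

(** * Mixed Poisson laws *)

Section mixed_poisson.
Context {R : realType}.
Local Notation mu := (@lebesgue_measure R).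
Local Notation I01 := (`[0, 1]%classic : set R).
Local Open Scope ereal_scope.

Lemma sum_poisson_pmfS r : (0 < r)%R ->
  \sum_(0 <= k <oo) ((k%:R + 1) * poisson_pmf r k)%:E = (r + 1)%:E :> \bar R.
Proof.
move=> r0; under eq_eseriesr do rewrite mulrDl mul1r EFinD.
rewrite nneseriesD; [|by move=> *; rewrite lee_fin ?mulr_ge0 ?poisson_pmf_ge0..].
by rewrite sum_poisson_pmf1// sum_poisson_pmf.
Qed.

Lemma sum_poisson_pmfS2 r : (0 < r)%R ->
  \sum_(0 <= k <oo) ((k%:R + 1) ^+ 2 * poisson_pmf r k)%:E =
  (r ^+ 2 + 3 * r + 1)%:E :> \bar R.
Proof.
move=> r0.
transitivity (\sum_(0 <= k <oo) (((k%:R ^+ 2 * poisson_pmf r k)%:E +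
    2%:E * (k%:R * poisson_pmf r k)%:E) + (poisson_pmf r k)%:E)).
  by apply: eq_eseriesr => k _; rewrite -EFinM -!EFinD; congr EFin; ring.
have k0 k : (0 <= k%:R * poisson_pmf r k)%R by rewrite mulr_ge0 ?poisson_pmf_ge0.
have k20 k : (0 <= k%:R ^+ 2 * poisson_pmf r k)%R by rewrite mulr_ge0 ?poisson_pmf_ge0 ?sqr_ge0.
rewrite nneseriesD; last 2 first.
- by move=> k _ _; rewrite adde_ge0 ?mule_ge0// lee_fin.
- by move=> k _ _; rewrite lee_fin poisson_pmf_ge0.
rewrite nneseriesD; last 2 first.
- by move=> k _ _; rewrite lee_fin.
- by move=> k _ _; rewrite mule_ge0// lee_fin.
rewrite nneseriesZl; last by move=> k _; rewrite lee_fin.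
rewrite sum_poisson_pmf2// sum_poisson_pmf1// sum_poisson_pmf//.
by rewrite -EFinM -!EFinD; congr EFin; ring.
Qed.

(** By Tonelli, a moment of the mixture p is the w-average of the corresponding Poisson moment G at
    the random rate. *)
Lemma mixed_poisson_sum (w r : R -> R) (p g : nat -> R) (G : R -> R) :
  measurable_fun I01 w -> measurable_fun I01 r ->
  (forall x, I01 x -> 0 <= w x)%R -> (forall x, I01 x -> 0 < r x)%R ->
  (forall k, (p k)%:E = \int[mu]_(x in I01) (w x * poisson_pmf (r x) k)%:E) ->
  (forall k, 0 <= g k)%R ->
  (forall y, 0 < y -> \sum_(0 <= k <oo) (g k * poisson_pmf y k)%:E = (G y)%:E)%R ->
  \sum_(0 <= k <oo) (g k * p k)%:E = \int[mu]_(x in I01) (w x * G (r x))%:E.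
Proof.
move=> mw mr w0 r0 pE g0 gG.
have mpmf k : measurable_fun I01 (fun x => (w x * poisson_pmf (r x) k)%:E).
  apply/measurable_EFinP; apply: measurable_funM => //.
  apply: (@measurableT_comp _ _ _ _ _ _ (poisson_pmf^~ k)) => //.
  exact: measurable_poisson_pmf.
have wpmf0 k x : I01 x -> (0 <= w x * poisson_pmf (r x) k)%R.
  by move=> x01; rewrite mulr_ge0 ?poisson_pmf_ge0 ?w0.
transitivity (\int[mu]_(x in I01)
    \sum_(0 <= k <oo) ((g k)%:E * (w x * poisson_pmf (r x) k)%:E)).
  rewrite integral_nneseries//; last 2 first.
  - by move=> k; exact: (emeasurable_funM (measurable_cst _) (mpmf k)).
  - by move=> k x x01; rewrite mule_ge0// lee_fin// wpmf0.
  apply: eq_eseriesr => k _; rewrite EFinM pE ge0_integralZl_EFin//.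
    by move=> x x01; rewrite lee_fin wpmf0.
  exact: mpmf.
apply: eq_integral => x /set_mem x01.
transitivity (\sum_(0 <= k <oo) ((w x)%:E * (g k * poisson_pmf (r x) k)%:E)).
  by apply: eq_eseriesr => k _; rewrite -!EFinM; congr EFin; ring.
rewrite nneseriesZl; last first.
  by move=> k _; rewrite lee_fin mulr_ge0 ?poisson_pmf_ge0.
by rewrite gG ?r0.
Qed.

(** The count law integrates a possibly non-Borel integrand against the type law [nu]. Absolute
    continuity of [nu] first lets h replace f; only then does the density formula apply. *)
Lemma mixed_poisson_law (f h w : R -> R) (a : R)
    (nu : {measure set R -> \bar R}) k :
  measurable_fun setT h -> {ae mu, forall x, I01 x -> f x = h x} ->
  measurable_fun I01 w -> (forall x, I01 x -> 0 <= w x)%R ->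
  (forall A, measurable A -> A `<=` I01 -> nu A = \int[mu]_(x in A) (w x)%:E) ->
  \int[nu]_(x in I01) (poisson_pmf (a * f x) k)%:E =
  \int[mu]_(x in I01) (w x * poisson_pmf (a * h x) k)%:E.
Proof.
move=> mh [N [mN N0 fhN]] mw w0 nuE.
have mI : measurable I01 by exact: measurable_itv.
transitivity (\int[nu]_(x in I01) (poisson_pmf (a * h x) k)%:E).
  apply: ge0_eq_integral_ae.
  - by move=> x _; rewrite lee_fin poisson_pmf_ge0.
  - by move=> x _; rewrite lee_fin poisson_pmf_ge0.
  (* [nu] is known only on subsets of [0, 1], so the exceptional set is cut down to that interval,
     where [nu] vanishes with Lebesgue measure. *)
  exists (N `&` I01); split; first exact: measurableI.
    rewrite nuE//; last exact: measurableI.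
    apply: null_set_integral; first exact: measurableI.
      by apply/measurable_EFinP; apply: (measurable_funS mI _ mw); exact: subIsetr.
    apply: (subset_measure0 _ mN _ N0); first exact: measurableI.
    exact: subIsetl.
  move=> x /= xfh; split.
    by apply: fhN => /= xh; apply: xfh => /xh ->.
  by apply: contrapT => x01; apply: xfh.
have mpmf : measurable_fun setT (fun x : measurableTypeR R => (poisson_pmf (a * h x) k)%:E).
  apply/measurable_EFinP.
  apply: (@measurableT_comp _ _ _ _ _ _ (poisson_pmf^~ k)).
    exact: measurable_poisson_pmf.
  exact: measurable_funM.
(* nu and mu live on R with the same Borel sets but two different displays, so
   nu is transported along the identity. *)
pose id_R : R -> measurableTypeR R := id.
have mid : measurable_fun setT id_R by move=> _ A mA; rewrite setTI.
pose id_mixin := isMeasurableFun.Build _ _ _ _ _ mid.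
pose id_mfun : {mfun R >-> measurableTypeR R} := HB.pack id_R id_mixin.
transitivity (\int[pushforward nu id_mfun]_(x in I01) (poisson_pmf (a * h x) k)%:E).
  rewrite [RHS]ge0_integral_pushforward//.
  - exact: measurable_funTS.
  - by move=> x _; rewrite lee_fin poisson_pmf_ge0.
transitivity (\int[mu]_(x in I01) ((poisson_pmf (a * h x) k)%:E * (w x)%:E)).
  apply: ge0_integral_density => //.
  - exact: measurable_funTS.
  - by move=> x _; rewrite lee_fin poisson_pmf_ge0.
by apply: eq_integral => x _; rewrite -EFinM mulrC.
Qed.

End mixed_poisson.

(** * The Galton-Watson tree *)

Section gw_bias.
Context {R : realType} (f : R -> R) (hf : kernel_class f).
Context (lambda : R) (lambda_gt0 : 0 < lambda).
Context (d : measure_display) (T : measurableType d) (P : probability T R).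
Context (X : seq nat -> {RV P >-> R}) (D : seq nat -> {RV P >-> nat}).
Hypothesis gw : multitype_gw_tree f lambda X D.
Local Notation mu := (@lebesgue_measure R).
Local Notation I01 := (`[0, 1]%classic : set R).
Local Notation b1 := (beta f 1).
Local Notation b2 := (beta f 2).
Local Notation b3 := (beta f 3).

Context (h : R -> R) (c M : R).
Hypothesis c0 : 0 < c.
Hypothesis hcM : forall x, c <= h x <= M.
Hypothesis mh : measurable_fun setT h.
Hypothesis fh : {ae mu, forall x, I01 x -> f x = h x}.

Let f_gt0 := kernel_gt0 hf.
Let h_gt0 := rep_gt0 c0 hcM.
Let b_gt0 m : 0 < beta f m := beta_gt0 f_gt0 c0 hcM mh fh m.

Let p (v : seq nat) k : R := fine (P (D v @^-1` [set k])).

Let pE v k : P (D v @^-1` [set k]) = (p v k)%:E.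
Proof.
rewrite fineK// fin_num_measure//.
exact: (measurable_fiber (measurable_funPT (D v)) k).
Qed.

Let rate x := lambda * b1 * h x.

Let rate_gt0 x : 0 < rate x.
Proof. by rewrite /rate !mulr_gt0. Qed.

Let mrate : measurable_fun setT rate.
Proof. exact: measurable_funM. Qed.

Let law v (w : R -> R) k : measurable_fun I01 w -> (forall x, I01 x -> 0 <= w x) ->
  (forall A, measurable A -> A `<=` I01 ->
     distribution P (X v) A = (\int[mu]_(x in A) (w x)%:E)%E) ->
  (p v k)%:E = (\int[mu]_(x in I01) (w x * poisson_pmf (rate x) k)%:E)%E.
Proof.
move=> mw w0 Xw; rewrite -pE.
have := gw_offspring gw v k measurableT; rewrite preimage_setT !setTI => ->.
exact: (@mixed_poisson_law _ f h w (lambda * b1) (distribution P (X v)) k).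
Qed.

Let root_law k :
  (p [::] k)%:E = (\int[mu]_(x in I01) (1 * poisson_pmf (rate x) k)%:E)%E.
Proof.
apply: (@law [::] (fun=> 1)) => // A mA AI.
rewrite (gw_root_type gw)// /uniform_prob; apply: eq_integral => x /set_mem/AI.
by rewrite /= in_itv/= /uniform_pdf => ->; rewrite subr0 invr1.
Qed.

Let child_law v k : v != [::] ->
  (p v k)%:E =
  (\int[mu]_(x in I01) ((b1^-1 * h x) * poisson_pmf (rate x) k)%:E)%E.
Proof.
move=> /eqP v0; apply: law.
- by apply: measurable_funTS; exact: measurable_funM.
- by move=> x _; rewrite mulr_ge0 ?invr_ge0 ?ltW.
move=> A mA AI; rewrite (gw_type gw)// setIidl//.
(* The density of the type is stated through f and is exchanged for its Borel version here. *)
apply: ge0_eq_integral_ae.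
- by move=> x Ax; rewrite lee_fin mulr_ge0 ?invr_ge0 ?ltW// f_gt0//; exact: AI.
- by move=> x _; rewrite lee_fin mulr_ge0 ?invr_ge0 ?ltW.
- have [N [mN N0 fhN]] := fh; exists N; split=> //.
  by apply: subset_trans fhN; apply: subsetC => x xh /AI /xh ->.
Qed.

Let root_sum (g : nat -> R) (G : R -> R) : (forall k, 0 <= g k) ->
  (forall y, 0 < y -> (\sum_(0 <= k <oo) (g k * poisson_pmf y k)%:E = (G y)%:E)%E) ->
  (\sum_(0 <= k <oo) (g k * p [::] k)%:E =
   \int[mu]_(x in I01) (G (rate x))%:E)%E.
Proof.
move=> g0 gG.
rewrite (@mixed_poisson_sum _ (fun=> 1) rate _ _ G)//.
  by under eq_integral do rewrite mul1r.
exact: measurable_funTS.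
Qed.

Let child_sum v (g : nat -> R) (G : R -> R) : v != [::] -> (forall k, 0 <= g k) ->
  (forall y, 0 < y -> (\sum_(0 <= k <oo) (g k * poisson_pmf y k)%:E = (G y)%:E)%E) ->
  (\sum_(0 <= k <oo) (g k * p v k)%:E =
   \int[mu]_(x in I01) ((b1^-1 * h x) * G (rate x))%:E)%E.
Proof.
move=> v0 g0 gG.
rewrite (@mixed_poisson_sum _ (fun x => b1^-1 * h x) rate _ _ G)//.
- by apply: measurable_funTS; exact: measurable_funM.
- exact: measurable_funTS.
- by move=> x _; rewrite mulr_ge0 ?invr_ge0 ?ltW.
- by move=> k; exact: child_law.
Qed.

Let rep3 := integral_rep3 f_gt0 c0 hcM mh fh.

Let root_mean : (\sum_(0 <= k <oo) (k%:R * p [::] k)%:E = (lambda * b1 ^+ 2)%:E)%E.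
Proof.
rewrite (@root_sum _ id)//; last exact: sum_poisson_pmf1.
transitivity (\int[mu]_(x in I01)
  ((lambda * b1) * h x ^+ 1 + 0 * h x ^+ 0 + 0 * h x ^+ 0)%:E)%E.
  by apply: eq_integral => x _; congr EFin; rewrite /rate; ring.
by rewrite rep3; congr EFin; ring.
Qed.

Let root_mean2 : (\sum_(0 <= k <oo) (k%:R ^+ 2 * p [::] k)%:E =
  (lambda * b1 ^+ 2 + lambda ^+ 2 * b1 ^+ 2 * b2)%:E)%E.
Proof.
rewrite (@root_sum _ (fun y => y + y ^+ 2))//; last exact: sum_poisson_pmf2.
transitivity (\int[mu]_(x in I01)
  ((lambda * b1) * h x ^+ 1 + (lambda * b1) ^+ 2 * h x ^+ 2 + 0 * h x ^+ 0)%:E)%E.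
  by apply: eq_integral => x _; congr EFin; rewrite /rate; ring.
by rewrite rep3; congr EFin; ring.
Qed.

(** The density [b1^-1 * h] size-biases the type of a child and raises each power of h by one: hence
    b2 here, and b3 in the second moment. *)
Let child_mean v : v != [::] ->
  (\sum_(0 <= k <oo) ((k%:R + 1) * p v k)%:E = (lambda * b2 + 1)%:E)%E.
Proof.
move=> v0; rewrite (@child_sum _ _ (fun y => y + 1))//; last exact: sum_poisson_pmfS.
have b1n : b1 != 0 by rewrite gt_eqF.
transitivity (\int[mu]_(x in I01)
  (lambda * h x ^+ 2 + b1^-1 * h x ^+ 1 + 0 * h x ^+ 0)%:E)%E.
  by apply: eq_integral => x _; congr EFin; rewrite /rate; field.
by rewrite rep3; congr EFin; field.
Qed.

Let child_mean2 v : v != [::] ->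
  (\sum_(0 <= k <oo) ((k%:R + 1) ^+ 2 * p v k)%:E =
   (lambda ^+ 2 * b1 * b3 + 3 * lambda * b2 + 1)%:E)%E.
Proof.
move=> v0; rewrite (@child_sum _ _ (fun y => y ^+ 2 + 3 * y + 1))//; last exact: sum_poisson_pmfS2.
have b1n : b1 != 0 by rewrite gt_eqF.
transitivity (\int[mu]_(x in I01)
  (lambda ^+ 2 * b1 * h x ^+ 3 + 3 * lambda * h x ^+ 2 + b1^-1 * h x ^+ 1)%:E)%E.
  by apply: eq_integral => x _; congr EFin; rewrite /rate; field.
by rewrite rep3; congr EFin; field.
Qed.

Let root0 : p [::] 0 = \int[mu]_(x in I01) expR (- (lambda * b1 * f x)).
Proof.
have lb0 : 0 < lambda * b1 by rewrite mulr_gt0.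
rewrite /Rintegral (ge0_integral_rep f_gt0 c0 hcM fh
  (phi := fun y => (expR (- (lambda * b1 * y)))%:E)); last first.
  by move=> x _; rewrite lee_fin expR_ge0.
rewrite -[LHS]/(fine (p [::] 0)%:E) root_law; congr fine.
apply: eq_integral => x _; rewrite poisson_pmf_pos// expr0 fact0 divr1 !mul1r.
by [].
Qed.

Let invseries (y : R) : R := \big[+%R/0]_(1 <= k <oo) (k%:R^-1 * (expR (- y) * y ^+ k / k`!%:R)).

Let root_inv : (\sum_(0 <= k <oo) (k%:R^-1 * p [::] k)%:E =
  (\int[mu]_(x in I01) invseries (lambda * b1 * f x))%:E)%E.
Proof.
have lb0 : 0 < lambda * b1 by rewrite mulr_gt0.
rewrite (@root_sum _ invseries)//; last by move=> y /sum_poisson_pmfV [].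
rewrite /Rintegral (ge0_integral_rep f_gt0 c0 hcM fh
  (phi := fun y => (invseries (lambda * b1 * y))%:E)); last first.
  move=> x x0; rewrite lee_fin.
  by have [_ /andP[]] := sum_poisson_pmfV (mulr_gt0 lb0 x0).
(* The real integral is the [fine] part of an extended one, which would hide an infinite value; the
   bound by 1 excludes this. *)
have inv01 x : 0 <= invseries (rate x) <= 1.
  have [_ /andP[-> le1]] := sum_poisson_pmfV (rate_gt0 x).
  by apply: le_trans le1 _; rewrite gerBl expR_ge0.
rewrite fineK// ge0_fin_numE; last first.
  by apply: integral_ge0 => x _; rewrite lee_fin; have /andP[] := inv01 x.
apply: (@le_lt_trans _ _ (\int[mu]_(x in I01) (cst 1%E x))%E).
  apply: ge0_le_integral_ae => //.
    by move=> x _; rewrite lee_fin; have /andP[] := inv01 x.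
  by apply: aeW => x _; rewrite lee_fin; have /andP[] := inv01 x.
by rewrite integral_cst//= lebesgue_measure01 mul1e ltry.
Qed.

Let N : T -> nat := D [::].
Let Y j t : R := (D [:: j] t)%:R + 1.

Let mN : measurable_fun setT N.
Proof. exact: (measurable_funPT (D [::])). Qed.

Let mY j : measurable_fun setT (Y j).
Proof.
apply: measurable_funD => //.
by apply: (@measurable_fun_fiber _ _ _ (measurable_funPT (D [:: j])) _ _ (fun n _ => n%:R : R)).
Qed.

Let Y_ge0 j t : 0 <= Y j t.
Proof. by rewrite addr_ge0. Qed.

Let fiber1 n j : (\int[P]_(t in N @^-1` [set n]) (Y j t)%:E =
  (p [::] n * (lambda * b2 + 1))%:E)%E.
Proof.
apply: (integral_count1 (gw_independent gw) pE n (u := [::]) (v := [:: j])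
  (g := fun k => k%:R + 1)) => //.
exact: child_mean.
Qed.

Let fiber2 n i j : (\int[P]_(t in N @^-1` [set n]) (Y i t * Y j t)%:E =
  (p [::] n * (if i == j then lambda ^+ 2 * b1 * b3 + 3 * lambda * b2 + 1
               else (lambda * b2 + 1) ^+ 2))%:E)%E.
Proof.
have [<-|ij] := eqVneq i j.
  under eq_integral do rewrite -expr2.
  apply: (integral_count1 (gw_independent gw) pE n (u := [::]) (v := [:: i])
    (g := fun k => (k%:R + 1) ^+ 2)) => //.
  exact: child_mean2.
rewrite expr2; apply: (integral_count2 (gw_independent gw) pE n
  (u := [::]) (v := [:: i]) (w := [:: j]) (g := fun k => k%:R + 1)
  (h := fun k => k%:R + 1)) => //.
- by rewrite /= !inE !eqseq_cons (negbTE ij).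
- exact: child_mean.
- exact: child_mean.
Qed.

(** For [N t = 0] the inverse is 0 by convention, so the formula already gives the value 0. *)
Let bias_eq t : friendship_bias (fun v => D v t) =
  (N t)%:R^-1 * \sum_(j < N t) Y j t - (N t)%:R.
Proof.
rewrite /friendship_bias -/(N t); case: eqP => // ->.
by rewrite invr0 mul0r subr0.
Qed.

(** The difference of the two sides is [lambda * b2 + lambda ^+ 2 * (b1 * b3 - b2 ^+ 2)]: mean plus
    variance of the rate of a child, as for every mixed Poisson law. It is the coefficient of the
    inverse-count series in the theorem. *)
Let variance_ge0 :
  (lambda * b2 + 1) ^+ 2 <= lambda ^+ 2 * b1 * b3 + 3 * lambda * b2 + 1.
Proof.
have cs := beta2_sqr_le f_gt0 c0 hcM mh fh; have := b_gt0 2.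
move: (beta f 1) (beta f 2) (beta f 3) cs => x y z yz y0.
have l0 := ltW lambda_gt0.
have ly : 0 <= lambda * y by rewrite mulr_ge0// ltW.
have lyz : lambda ^+ 2 * y ^+ 2 <= lambda ^+ 2 * (x * z).
  by rewrite ler_wpM2l// sqr_ge0.
nra.
Qed.

Lemma gw_bias_mean :
  'E_P[fun t => friendship_bias (fun v => D v t)]%E =
  (1 - (lambda * b2 + 1) *
         \int[mu]_(x in I01) expR (- (lambda * b1 * f x))
   + lambda * (b2 - b1 ^+ 2))%:E.
Proof.
rewrite unlock; under eq_integral do rewrite bias_eq.
rewrite (bias_mean mN mY Y_ge0 (pE [::]) root_mean fiber1) root0.
by congr EFin; ring.
Qed.

Lemma gw_bias_second_moment :
  'E_P[fun t => (friendship_bias (fun v => D v t) ^+ 2)%R]%E =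
  (lambda * (b2 + lambda * (b1 * b3 - b2 ^+ 2)) *
     \int[mu]_(x in I01)
       (\big[+%R/0]_(1 <= k <oo)
          (k%:R^-1 * (expR (- (lambda * b1 * f x)) *
                      (lambda * b1 * f x) ^+ k / k`!%:R)))
   - (lambda ^+ 2 * b2 ^+ 2 + 2 * lambda * b2 + 1) *
       \int[mu]_(x in I01) expR (- (lambda * b1 * f x))
   + lambda ^+ 2 * (b2 ^+ 2 - b2 * b1 ^+ 2)
   + lambda * (2 * b2 - b1 ^+ 2) + 1)%:E.
Proof.
rewrite unlock; under eq_integral do rewrite bias_eq.
rewrite (bias_second_moment mN mY Y_ge0 (pE [::]) root_mean root_mean2 root_inv
  variance_ge0 fiber1 fiber2) root0.
by congr EFin; ring.
Qed.

End gw_bias.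

(** * Limits *)

Section limits.
Context {R : realType}.
Implicit Types (E : R -> \bar R) (F : R -> R).

Lemma cvg_at_right0_linear E F (K : R) :
  (forall x, 0 < x -> E x = (F x)%:E) ->
  (forall x, 0 < x <= 1 -> `|F x| <= K * x) ->
  E x @[x --> 0^'+] --> 0%E.
Proof.
move=> EF FK.
have K0 : 0 <= K.
  by have := FK 1; rewrite ltr01 lexx mulr1 => /(_ isT); exact: le_trans.
(* K may be 0, so the division below is by K + 1. *)
have K1 : 0 < K + 1 by rewrite (lt_le_trans ltr01)// lerDr.
apply: cvg_EFin.
  by near=> x; rewrite EF.
apply/cvgrPdist_le => /= e e0; near=> x.
have x0 : 0 < x by [].
have x1 : x <= 1 by near: x; exact: nbhs_right_le.
rewrite sub0r normrN EF//=; apply: le_trans (FK x _) _; first by rewrite x0.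
apply: (@le_trans _ _ ((K + 1) * x)); first by rewrite ler_wpM2r ?lerDl// ltW.
rewrite mulrC -ler_pdivlMr//.
near: x; apply: nbhs_right_le; exact: divr_gt0.
Unshelve. all: end_near. Qed.

Lemma cvg_pinfty_linear E F (a K : R) : 0 < a ->
  (forall x, 0 < x -> E x = (F x)%:E) ->
  (forall x, 0 < x -> a * x - K <= F x) ->
  E x @[x --> +oo] --> +oo%E.
Proof.
move=> a0 EF FK; apply/cvgeyPge => A; near=> x.
have x0 : 0 < x by [].
rewrite EF// lee_fin; apply: le_trans (FK x x0).
rewrite lerBrDr -ler_pdivrMl//.
Unshelve. all: end_near. Qed.

Lemma mul_expRN_le (t : R) : 0 < t -> t * expR (- t) <= 1.
Proof.
move=> t0; rewrite expRN ler_pdivrMr ?expR_gt0// mul1r.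
by apply: le_trans (expR_ge1Dx t); rewrite lerDr.
Qed.

Lemma sqr_mul_expRN_le (t : R) : 0 < t -> t ^+ 2 * expR (- t) <= 2.
Proof.
move=> t0; rewrite expRN ler_pdivrMr ?expR_gt0//.
have := expR_ge1Dxn 1 (ltW t0); rewrite -[2`!]/2%N.
by move: (expR t) (t ^+ 2) => x y; lra.
Qed.

End limits.

Section bias_limits.
Context {R : realType} (f : R -> R) (hf : kernel_class f).
Local Notation mu := (@lebesgue_measure R).
Local Notation I01 := (`[0, 1]%classic : set R).
Local Notation b1 := (beta f 1).
Local Notation b2 := (beta f 2).
Local Notation b3 := (beta f 3).

Context (h : R -> R) (c M : R).
Hypothesis c0 : 0 < c.
Hypothesis hcM : forall x, c <= h x <= M.
Hypothesis mh : measurable_fun setT h.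
Hypothesis fh : {ae mu, forall x, I01 x -> f x = h x}.

Let f_gt0 := kernel_gt0 hf.
Let h_gt0 := rep_gt0 c0 hcM.
Let b_gt0 m : 0 < beta f m := beta_gt0 f_gt0 c0 hcM mh fh m.

(** The probability that the root has no child, as a function of the intensity x. *)
Let leaf (x : R) := \int[mu]_(y in I01) expR (- (x * b1 * f y)).

Let leafE x : leaf x = \int[mu]_(y in I01) expR (- (x * b1 * h y)).
Proof.
rewrite /leaf /Rintegral (ge0_integral_rep f_gt0 c0 hcM fh
  (phi := fun y => (expR (- (x * b1 * y)))%:E))//.
Qed.

Let leaf_int x : 0 < x -> mu.-integrable I01 (fun y => (expR (- (x * b1 * h y)))%:E).
Proof.
move=> x0; apply: (integrable_rep hcM mh (phi := fun y => expR (- (x * b1 * y))) (K := 1)).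
  by apply: measurableT_comp => //; apply: measurableT_comp => //; exact: measurable_funM.
move=> y /andP[cy _]; rewrite ger0_norm ?expR_ge0// -expR0 ler_expR oppr_le0.
by rewrite !mulr_ge0// ltW// (lt_le_trans c0).
Qed.

Let leaf_ge0 x : 0 <= leaf x.
Proof. by apply: Rintegral_ge0 => y _; exact: expR_ge0. Qed.

(** The lower bound c on h gives exponential decay in x, which absorbs the factors x and x^2
    standing before [leaf]. *)
Let leaf_le x : 0 < x -> leaf x <= expR (- (x * b1 * c)).
Proof.
move=> x0; rewrite leafE.
apply: (@le_trans _ _ (\int[mu]_(y in I01) expR (- (x * b1 * c)))).
  apply: le_Rintegral => //.
  - exact: leaf_int.
  - apply: measurable_bounded_integrable => //.
      by rewrite /= lebesgue_measure01 ltry.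
    exists 1; split; rewrite ?num_real// => K K1 y _ /=.
    rewrite ger0_norm ?expR_ge0// (le_trans _ (ltW K1))// -expR0 ler_expR oppr_le0.
    by rewrite !mulr_ge0// ltW.
  - move=> y _; rewrite ler_expR lerN2 ler_pM2l ?mulr_gt0//.
    by have /andP[] := hcM y.
by rewrite Rintegral_cst//= lebesgue_measure01 mulr1.
Qed.

Let leaf_le1 x : 0 < x -> leaf x <= 1.
Proof.
move=> x0; apply: le_trans (leaf_le x0) _.
by rewrite -expR0 ler_expR oppr_le0 !mulr_ge0// ltW.
Qed.

(** The tangent bound 1 - t <= exp(-t) is integrated, and the integral of h is b1. *)
Let leaf_ge x : 0 < x -> 1 - x * b1 ^+ 2 <= leaf x.
Proof.
move=> x0; rewrite leafE.
have <- : \int[mu]_(y in I01) (1 * h y ^+ 0 + (- (x * b1)) * h y ^+ 1 + 0 * h y ^+ 0) =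
    1 - x * b1 ^+ 2.
  rewrite /Rintegral (integral_rep3 f_gt0 c0 hcM mh fh)/=.
  by rewrite (beta0 f_gt0 c0 hcM mh fh); ring.
apply: le_Rintegral => //.
- apply: (integrable_rep hcM mh
    (phi := fun y => 1 * y ^+ 0 + (- (x * b1)) * y ^+ 1 + 0 * y ^+ 0) (K := 1 + x * b1 * M)).
    by do ![apply: measurable_funD|apply: measurable_funM|apply: measurable_funX].
  move=> y /andP[cy yM]; have y0 : 0 <= y by rewrite ltW// (lt_le_trans c0).
  rewrite expr0 expr1 !mul1r mul0r addr0 mulNr (le_trans (ler_normB _ _))//.
  by rewrite normr1 lerD2l ger0_norm ?mulr_ge0 ?ler_wpM2l ?mulr_ge0// ltW.
- exact: leaf_int.
- move=> y _; rewrite expr0 expr1 !mul1r mul0r addr0 mulNr.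
  exact: expR_ge1Dx.
Qed.

(** Comes from t exp(-t) <= 1 at [t = x * (b1 * c)], divided by [b1 * c]. *)
Let K1 := (b1 * c)^-1.

Let bc_gt0 : 0 < b1 * c.
Proof. exact: mulr_gt0. Qed.

Let mul_leaf_le x : 0 < x -> x * leaf x <= K1.
Proof.
move=> x0; rewrite /K1 -[leRHS]mul1r ler_pdivlMr//.
apply: le_trans (mul_expRN_le (mulr_gt0 x0 bc_gt0)).
rewrite mulrAC ler_pM2l; last exact: mulr_gt0.
by rewrite mulrA leaf_le.
Qed.

Let sqr_mul_leaf_le x : 0 < x -> x ^+ 2 * leaf x <= 2 * K1 ^+ 2.
Proof.
move=> x0; rewrite /K1 exprVn ler_pdivlMr ?exprn_gt0//.
apply: le_trans (sqr_mul_expRN_le (mulr_gt0 x0 bc_gt0)).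
rewrite mulrAC -exprMn ler_pM2l; last by rewrite exprn_gt0// mulr_gt0.
by rewrite mulrA leaf_le.
Qed.

(** The expectation of [1 / d_phi] on the event that the root has a child. *)
Let inv (x : R) := \int[mu]_(y in I01)
  (\big[+%R/0]_(1 <= k <oo)
     (k%:R^-1 * (expR (- (x * b1 * f y)) * (x * b1 * f y) ^+ k / k`!%:R))).

Let inv01 x : 0 < x -> 0 <= inv x <= 1.
Proof.
move=> x0; pose s (y : R) : R := \big[+%R/0]_(1 <= k <oo)
  (k%:R^-1 * (expR (- (x * b1 * y)) * (x * b1 * y) ^+ k / k`!%:R)).
have s01 y : 0 < y -> 0 <= s y <= 1.
  move=> y0; have [_ /andP[-> sy]] := sum_poisson_pmfV (mulr_gt0 (mulr_gt0 x0 (b_gt0 1)) y0).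
  by apply: le_trans sy _; rewrite gerBl expR_ge0.
have fs y : I01 y -> 0 <= s (f y) <= 1 by move=> y01; apply/s01/f_gt0.
have int1 : (\int[mu]_(y in I01) (s (f y))%:E <= 1)%E.
  rewrite -[leRHS](_ : \int[mu]_(y in I01) (cst 1%E y) = 1)%E; last first.
    by rewrite integral_cst//= lebesgue_measure01 mul1e.
  apply: ge0_le_integral_ae => //.
    by move=> y /fs /andP[]; rewrite lee_fin.
  by apply: aeW => y /fs /andP[]; rewrite lee_fin.
have int0 : (0 <= \int[mu]_(y in I01) (s (f y))%:E)%E.
  by apply: integral_ge0 => y /fs /andP[]; rewrite lee_fin.
rewrite /inv /Rintegral -/(s _) fine_ge0//= -lee_fin fineK//.
by rewrite ge0_fin_numE// (le_lt_trans int1)// ltry.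
Qed.

Let mean x := 1 - (x * b2 + 1) * leaf x + x * (b2 - b1 ^+ 2).

Let second_moment x :=
  x * (b2 + x * (b1 * b3 - b2 ^+ 2)) * inv x
  - (x ^+ 2 * b2 ^+ 2 + 2 * x * b2 + 1) * leaf x
  + x ^+ 2 * (b2 ^+ 2 - b2 * b1 ^+ 2) + x * (2 * b2 - b1 ^+ 2) + 1.

Let b12 : b1 ^+ 2 <= b2 := beta1_sqr_le f_gt0 c0 hcM mh fh.
Let b23 : b2 ^+ 2 <= b1 * b3 := beta2_sqr_le f_gt0 c0 hcM mh fh.

(** [1 - leaf x] lies between 0 and [x * b1 ^+ 2], and the remaining terms carry a factor x. *)
Lemma bias_mean_near0 x : 0 < x <= 1 -> `|mean x| <= 2 * b2 * x.
Proof.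
move=> /andP[x0 _]; rewrite /mean.
move: (leaf_le1 x0) (leaf_ge x0) (leaf_ge0 x) (b_gt0 2) b12.
move: (leaf x) (b1 ^+ 2) (beta f 2) => L b11 b2' L1 Lb L0 b20 b11b2.
have xb : 0 <= x * b2' by rewrite mulr_ge0// ltW.
have xbL0 : 0 <= x * b2' * L by rewrite mulr_ge0.
have xbL1 : x * b2' * L <= x * b2' by rewrite ler_piMr.
have xd : 0 <= x * (b2' - b11) by rewrite mulr_ge0 ?subr_ge0// ltW.
by rewrite ler_norml; apply/andP; split; lra.
Qed.

(** The slope is the variance of f at a uniform point; [x * leaf x] stays bounded, so only a
    constant is lost. *)
Lemma bias_mean_large : exists K, forall x, 0 < x ->
  (b2 - b1 ^+ 2) * x - K <= mean x.
Proof.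
exists (b2 * K1) => x x0; rewrite /mean.
have : b2 * (x * leaf x) <= b2 * K1 by rewrite ler_wpM2l ?mul_leaf_le// ltW.
move: (leaf_le1 x0).
move: (leaf x) (b2 * K1) (b1 ^+ 2) (beta f 2) => L K b11 b2' L1; lra.
Qed.

Lemma bias_second_moment_near0 : exists K, forall x, 0 < x <= 1 ->
  `|second_moment x| <= K * x.
Proof.
(* With x^2 <= x, the first two summands bound the series term, the next two the [leaf] term, the
   fifth the quadratic term; the last covers the linear term together with [1 - leaf x]. *)
exists (b2 + (b1 * b3 - b2 ^+ 2) + b2 ^+ 2 + 2 * b2 + b2 * (b2 - b1 ^+ 2) + 2 * b2).
move=> x /andP[x0 x1]; rewrite /second_moment.
move: (leaf_le1 x0) (leaf_ge x0) (leaf_ge0 x) (inv01 x0) (b_gt0 2) b12 b23.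
move: (leaf x) (inv x) (b1 ^+ 2) (b1 * beta f 3) (beta f 2).
move=> L S b11 b13 b2' L1 Lb L0 /andP[S0 S1] b20 b11b2 b22b13.
have x0' := ltW x0; have b20' := ltW b20.
have xx : x ^+ 2 <= x by rewrite expr2 ler_piMr.
have x20 : 0 <= x ^+ 2 by rewrite sqr_ge0.
set k := b13 - b2' ^+ 2; have k0 : 0 <= k by rewrite subr_ge0.
set w := b2' * (b2' - b11); have w0 : 0 <= w by rewrite mulr_ge0// subr_ge0.
have -> : b2' ^+ 2 - b2' * b11 = w by rewrite /w; ring.
set q := x ^+ 2 * b2' ^+ 2 + 2 * x * b2'.
have q0 : 0 <= q by rewrite addr_ge0 ?mulr_ge0// sqr_ge0.
have qx : q <= x * (b2' ^+ 2 + 2 * b2').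
  have : x ^+ 2 * b2' ^+ 2 <= x * b2' ^+ 2 by rewrite ler_wpM2r ?sqr_ge0.
  by rewrite /q; lra.
have qL0 : 0 <= q * L by rewrite mulr_ge0.
have qL1 : q * L <= q by rewrite ler_piMr.
set s := x * (b2' + x * k).
have s0 : 0 <= s by rewrite mulr_ge0// addr_ge0// mulr_ge0.
have sx : s <= x * (b2' + k).
  by rewrite ler_wpM2l// lerD2l ler_piMl.
have sS0 : 0 <= s * S by rewrite mulr_ge0.
have sS1 : s * S <= s by rewrite ler_piMr.
have wx : x ^+ 2 * w <= x * w by rewrite ler_wpM2r.
have wx0 : 0 <= x ^+ 2 * w by rewrite mulr_ge0.
have xd : 0 <= x * (b2' - b11) by rewrite mulr_ge0 ?subr_ge0.
have xw : 0 <= x * w by rewrite mulr_ge0.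
have xk : 0 <= x * k by rewrite mulr_ge0.
have xb : 0 <= x * b2' by rewrite mulr_ge0.
have xb2 : 0 <= x * b2' ^+ 2 by rewrite mulr_ge0 ?sqr_ge0.
(* Once the products are treated as atoms with the bounds just proved, the claim is linear. *)
rewrite mulrDl mul1r ler_norml; move: (q * L) (s * S) (x ^+ 2 * w) qL0 qL1 sS0 sS1 wx wx0.
clearbody q s w k => qL sS xw2 *; apply/andP; split; lra.
Qed.

(** The linear coefficient [2 * b2 - b1 ^+ 2] is at least b2. The series term and the quadratic term
    are nonnegative and dropped; the terms with [leaf] cost a constant. *)
Lemma bias_second_moment_large : exists K, forall x, 0 < x ->
  b2 * x - K <= second_moment x.
Proof.
exists (b2 ^+ 2 * (2 * K1 ^+ 2) + 2 * b2 * K1) => x x0; rewrite /second_moment.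
have : b2 * (x * leaf x) <= b2 * K1 by rewrite ler_wpM2l ?mul_leaf_le// ltW.
have : b2 ^+ 2 * (x ^+ 2 * leaf x) <= b2 ^+ 2 * (2 * K1 ^+ 2).
  by rewrite ler_wpM2l ?sqr_mul_leaf_le// sqr_ge0.
move: (leaf_le1 x0) (inv01 x0) (b_gt0 2) b12 b23.
move: (leaf x) (inv x) (b1 ^+ 2) (b1 * beta f 3) (beta f 2) K1.
move=> L S b11 b13 b2' K L1 /andP[S0 _] b20 b11b2 b22b13.
move: (b2' ^+ 2 * (2 * K ^+ 2)) => K2 xxL xL.
have x0' := ltW x0; have b20' := ltW b20.
have : 0 <= x * (b2' + x * (b13 - b2' ^+ 2)) * S.
  by rewrite !mulr_ge0// addr_ge0// mulr_ge0// subr_ge0.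
have : 0 <= x ^+ 2 * (b2' * (b2' - b11)).
  by rewrite mulr_ge0 ?sqr_ge0// mulr_ge0// subr_ge0.
have : 0 <= x * (b2' - b11) by rewrite mulr_ge0// subr_ge0.
move: (x * (b2' + x * (b13 - b2' ^+ 2)) * S) => A; lra.
Qed.

End bias_limits.

Theorem theorem4p5 (R : realType) (f : R -> R) (hf : kernel_class f) :
  (forall (lambda : R) (d : measure_display) (T : measurableType d)
      (P : probability T R)
      (X : seq nat -> {RV P >-> R}) (D : seq nat -> {RV P >-> nat}),
    0 < lambda -> multitype_gw_tree f lambda X D ->
    'E_P[fun t => friendship_bias (fun v => D v t)]%E =
      (1 - (lambda * beta f 2 + 1) *
             \int[lebesgue_measure]_(x in `[0, 1])
               expR (- (lambda * beta f 1 * f x))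
       + lambda * (beta f 2 - beta f 1 ^+ 2))%:E /\
    'E_P[fun t => (friendship_bias (fun v => D v t) ^+ 2)%R]%E =
      (lambda * (beta f 2 + lambda * (beta f 1 * beta f 3 - beta f 2 ^+ 2)) *
         \int[lebesgue_measure]_(x in `[0, 1])
           (\big[+%R/0]_(1 <= k <oo)
              (k%:R^-1 * (expR (- (lambda * beta f 1 * f x)) *
                          (lambda * beta f 1 * f x) ^+ k / k`!%:R)))
       - (lambda ^+ 2 * beta f 2 ^+ 2 + 2 * lambda * beta f 2 + 1) *
           \int[lebesgue_measure]_(x in `[0, 1])
             expR (- (lambda * beta f 1 * f x))
       + lambda ^+ 2 * (beta f 2 ^+ 2 - beta f 2 * beta f 1 ^+ 2)
       + lambda * (2 * beta f 2 - beta f 1 ^+ 2) + 1)%:E) /\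
  (forall (d : R -> measure_display) (T : forall lambda, measurableType (d lambda))
      (P : forall lambda, probability (T lambda) R)
      (X : forall lambda, seq nat -> {RV (P lambda) >-> R})
      (D : forall lambda, seq nat -> {RV (P lambda) >-> nat}),
    (forall lambda, 0 < lambda ->
      multitype_gw_tree f lambda (X lambda) (D lambda)) ->
    [/\ 'E_(P lambda)[fun t => friendship_bias (fun v => D lambda v t)]%E
          @[lambda --> 0^'+] --> 0%E,
        'E_(P lambda)[fun t => (friendship_bias (fun v => D lambda v t) ^+ 2)%R]%E
          @[lambda --> 0^'+] --> 0%E,
        (~ ae_constant f ->
        'E_(P lambda)[fun t => friendship_bias (fun v => D lambda v t)]%E
          @[lambda --> +oo] --> +oo%E) &
        'E_(P lambda)[fun t => (friendship_bias (fun v => D lambda v t) ^+ 2)%R]%E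
          @[lambda --> +oo] --> +oo%E]).
Proof.
have [h [c [M [c0 hcM mh fh]]]] := kernel_ae_measurable hf.
split=> [lambda d T P X D lambda_gt0 gw|d T P X D gw].
  split.
    exact: (gw_bias_mean hf lambda_gt0 gw c0 hcM mh fh).
  exact: (gw_bias_second_moment hf lambda_gt0 gw c0 hcM mh fh).
have mean lambda (lambda_gt0 : 0 < lambda) :=
  gw_bias_mean hf lambda_gt0 (gw lambda lambda_gt0) c0 hcM mh fh.
have moment2 lambda (lambda_gt0 : 0 < lambda) :=
  gw_bias_second_moment hf lambda_gt0 (gw lambda lambda_gt0) c0 hcM mh fh.
have b2_gt0 := beta_gt0 (kernel_gt0 hf) c0 hcM mh fh 2.
split.
- exact: (cvg_at_right0_linear mean (bias_mean_near0 hf c0 hcM mh fh)).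
- have [K K_ge] := bias_second_moment_near0 hf c0 hcM mh fh.
  exact: (cvg_at_right0_linear moment2 K_ge).
- move=> /(beta1_sqr_lt (kernel_gt0 hf) c0 hcM mh fh); rewrite -subr_gt0 => var_gt0.
  have [K K_le] := bias_mean_large hf c0 hcM mh fh.
  exact: (cvg_pinfty_linear var_gt0 mean K_le).
- have [K K_le] := bias_second_moment_large hf c0 hcM mh fh.
  exact: (cvg_pinfty_linear b2_gt0 moment2 K_le).
Qed.
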